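(* Let $\lambda,\mu_1,\mu_2>0$, $\rho_i=\lambda/\mu_i$. Consider the tandem Jackson network with capacity $m$ ($1\le m\le\infty$) at the first queue, with level $Y_t$ (number in queue 2) and phase $J_t$ (number in queue 1). Let $P_1^K(i,j)$ be the probability that, starting from level $1$ and phase $i$, the process reaches level $K$ before level $0$ and is in phase $j$ at the moment it first reaches level $K$. 1. Suppose $m$ is finite and the network is stable, that is, $\rho_2<(1-\rho_1^{m+1})/(1-\rho_1^m)$ if $\rho_1\ne1$, and $\rho_2<1+1/m$ if $\rho_1=1$. Let $h_m$ be the maximal eigenvalue of $H_m$. Then for all phases $i,j\in\{0,\dots,m\}$, $$\lim_{K\to\infty}\frac{\log P_1^K(i,j)}{K}=\log(h_m).$$ 2. Suppose $m=\infty$ and $\lambda<\min\{\mu_1,\mu_2\}$. Let $\eta\in(0,1)$ be the unique zero in $(0,1)$ of $\tau(z)=-\lambda-\mu_1-\mu_2(1-z)+2\sqrt{\lambda\mu_1/z}$. Then for all phases $i,j\in\{0,1,\dots\}$: (a) if $\mu_1\le\mu_2$, then $\lim_{K\to\infty}\frac{\log P_1^K(i,j)}{K}=\log(\eta)$; (b) if $\mu_1>\mu_2$, then $\lim_{K\to\infty}\frac{\log P_1^K(i,j)}{K}=\log(\rho_2)$.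
   Context: The tandem Jackson network with capacity $m$ at the first queue is the continuous-time Markov chain $(Y_t,J_t)$ on $\{0,1,\dots\}\times\{0,\dots,m\}$ (on $\{0,1,\dots\}^2$ if $m=\infty$) with transitions $(k,j)\to(k,j+1)$ at rate $\lambda$ for $j<m$; $(k,j)\to(k+1,j-1)$ at rate $\mu_1$ for $j\ge1$; $(k,j)\to(k-1,j)$ at rate $\mu_2$ for $k\ge1$. For finite $m$ the $(m+1)\times(m+1)$ blocks of its generator are: $Q_0(j,j-1)=\mu_1$ ($1\le j\le m$), other entries $0$; $Q_1(j,j+1)=\lambda$ ($0\le j<m$), $Q_1(0,0)=-(\lambda+\mu_2)$, $Q_1(j,j)=-(\lambda+\mu_1+\mu_2)$ ($1\le j\le m-1$), $Q_1(m,m)=-(\mu_1+\mu_2)$, other entries $0$; $Q_2=\mu_2I$. The matrix $H_m$ is the minimal nonnegative solution of $Q_0+Q_1H+Q_2H^2=0$. It is the elementwise increasing limit as $k\to\infty$ of the matrices whose $(i,j)$ entry is the probability that, starting from level $k$ and phase $i$, the process reaches level $k+1$ before level $0$ and is in phase $j$ when it does so.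
   Formalization: In part 1 the phase j is restricted to 0,…,m−1: a new level K≥2 is always entered with phase at most m−1, so P_1^K(i,m)=0 and the claimed limit fails at j=m; all phases i in {0,…,m} are kept. *)

(* Defs.v *)
From HB Require Import structures.
From mathcomp Require Import all_boot all_order all_algebra.
From mathcomp Require Import all_classical all_reals all_analysis.
From mathcomp Require Import complex.

Set Implicit Arguments.
Unset Strict Implicit.
Unset Printing Implicit Defensive.

Import Order.TTheory GRing.Theory Num.Theory.
Import numFieldNormedType.Exports.

Local Open Scope classical_set_scope.
Local Open Scope ring_scope.

(** * Continuous-time Markov chains on a countable state space *)

Section MarkovJumpProcess.
Context {R : realType} {S : countType}.
Implicit Types (q : S -> S -> R) (x y : S).

(* [q x y] is the rate of the transition from [x] to [y] for [x <> y], with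
   [q x x = 0].  The sum is a finitely supported one: it is meaningful when
   [q x] has finite support, as is the case for the rates used below. *)
Definition exit_rate q x : R := \sum_(y \in [set: S]) q x y.

(* Division by zero is harmless: no state of the network below is absorbing. *)
Definition jump_prob q x y : R := q x y / exit_rate q x.

(* [X t] (for [t >= 0]) is a continuous-time Markov chain with transition
   rates [q] started at [x0], in the jump chain / holding time form: [Z n] is
   the [n]-th state visited and [E n] the time spent there.  The last clause
   says that [Z] is a Markov chain from [x0] with transition probabilities
   [jump_prob q] and that, given [Z], the [E n] are independent and
   exponential with parameters [exit_rate q (Z n)].  The fourth clause makes
   the paths right-continuous step functions on the whole of [0, +oo[: there
   is no explosion, which for bounded exit rates holds almost surely anyway. *)
Definition markov_jump_process (d : measure_display) (Om : measurableType d)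
    (P : probability Om R) q x0 (X : R -> Om -> S) : Prop :=
  exists (Z : nat -> Om -> S) (E : nat -> Om -> R),
  [/\ forall n x, measurable (Z n @^-1` [set x]),
      forall n, measurable_fun [set: Om] (E n),
      forall n w, 0 < E n w,
      forall t w, 0 <= t -> exists n,
        [/\ \sum_(k < n) E k w <= t, t < \sum_(k < n.+1) E k w
          & X t w = Z n w]
    & forall n (z : nat -> S) (s : nat -> R), (forall k, 0 <= s k) ->
        P [set w | forall k, (k <= n)%N -> Z k w = z k /\ s k < E k w] =
        ((z 0 == x0)%:R * (\prod_(k < n) jump_prob q (z k) (z k.+1)) *
         (\prod_(k < n.+1) expR (- (exit_rate q (z k) * s k))))%:E].

End MarkovJumpProcess.

(** * The tandem Jackson network *)

(* The capacity of the first queue is [Some m], or [None] if it is infinite. *)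
Definition below_capacity (cap : option nat) (j : nat) : bool :=
  if cap is Some m then (j < m)%N else true.

(* A state is a pair (level, phase) = (second queue, first queue). *)
Definition tandem_rate {R : realType} (lam mu1 mu2 : R) (cap : option nat)
    (x y : nat * nat) : R :=
  let: (k, j) := x in
  if below_capacity cap j && (y == (k, j.+1)) then lam
  else if (0 < j)%N && (y == (k.+1, j.-1)) then mu1
  else if (0 < k)%N && (y == (k.-1, j)) then mu2
  else 0.

(* The level reaches [K] before [0], and the phase is [j] when it first does. *)
Definition reach_event {R : realType} {Om : Type} (X : R -> Om -> nat * nat)
    (K j : nat) : set Om :=
  [set w | exists t : R, [/\ 0 <= t, X t w = (K, j) &
     forall s : R, 0 <= s -> s < t -> (X s w).1 <> 0%N /\ (X s w).1 <> K]].

Definition reach_prob {R : realType} {d : measure_display}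
    {Om : measurableType d} (P : probability Om R) (X : R -> Om -> nat * nat)
    (K j : nat) : R :=
  fine (P (reach_event X K j)).

(** * Finite capacity: the matrix H and its maximal eigenvalue *)

Section Blocks.
Context {R : realType}.
Variables (lam mu1 mu2 : R) (m : nat).

Definition Q0 : 'M[R]_m.+1 :=
  \matrix_(i, j) if i == j.+1 :> nat then mu1 else 0.

Definition Q1 : 'M[R]_m.+1 :=
  \matrix_(i, j)
    if j == i.+1 :> nat then lam
    else if i == j then
      if i == 0 :> nat then - (lam + mu2)
      else if i == m :> nat then - (mu1 + mu2)
      else - (lam + mu1 + mu2)
    else 0.

Definition Q2 : 'M[R]_m.+1 := mu2%:M.

Definition nonneg_solution (H : 'M[R]_m.+1) : Prop :=
  (forall i j, 0 <= H i j) /\ Q0 + Q1 *m H + Q2 *m (H *m H) = 0.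

Definition minimal_nonneg_solution (H : 'M[R]_m.+1) : Prop :=
  nonneg_solution H /\
  forall G : 'M[R]_m.+1, nonneg_solution G -> forall i j, H i j <= G i j.

Definition stable : Prop :=
  let rho1 := lam / mu1 in
  let rho2 := lam / mu2 in
  (rho1 != 1 -> rho2 < (1 - rho1 ^+ m.+1) / (1 - rho1 ^+ m)) /\
  (rho1 = 1 -> rho2 < 1 + m%:R^-1).

End Blocks.

(* [h] is a real eigenvalue, of maximal modulus among all complex ones. *)
Definition maximal_eigenvalue {R : realType} {n : nat} (A : 'M[R]_n) (h : R) :
    Prop :=
  [/\ 0 <= h, eigenvalue A h
    & forall z : R[i], eigenvalue (map_mx (real_complex R) A) z ->
        `|z| <= real_complex R h].

(** * Infinite capacity *)

Definition tau {R : realType} (lam mu1 mu2 z : R) : R :=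
  - lam - mu1 - mu2 * (1 - z) + 2 * Num.sqrt (lam * mu1 / z).

(* Main.v *)
Require Import Defs.
From HB Require Import structures.
From mathcomp Require Import all_boot all_order all_algebra.
From mathcomp Require Import all_classical all_reals all_analysis.
From mathcomp Require Import complex.
From mathcomp Require Import ring lra zify.
Import Order.TTheory GRing.Theory Num.Theory.
Import numFieldNormedType.Exports.
Local Open Scope classical_set_scope.
Local Open Scope ring_scope.

(** The proof replaces the spectral theory of [H] by explicit harmonic functions.
    If a vector [x] satisfies [(Q0 + z Q1 + z^2 Q2) x = 0], then [x_j / z^k] is a
    harmonic function of the state [(k, j)] above level 0 that gains a factor
    [1 / z] per level.

    Upper bound ([upcross_le]): a positive superharmonic function is a
    supermartingale, and stopping it at level [K] bounds the probability of an
    upcrossing to [K] by a multiple of [z^K].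

    Lower bound ([upcross_ge]): if [x] is positive on the phases [0, ..., n] and
    subharmonic there, and [x_(n+1) <= 0] when phase [n + 1] is possible, then for
    [z < 1] the function [x_j / z^k - C] is subharmonic and nonpositive at level 0
    for a suitable constant [C].  A minimum principle on a finite box, together with
    explicit paths near both ends ([upcross_near]), bounds the probability below by
    a multiple of [z^K].

    It remains to find the vectors.  They are given by a three-term recursion.  For
    finite capacity the constant vector solves it at [z = 1], and stability says
    that the boundary condition at full capacity is positive just below 1; the
    intermediate value theorem yields a root [h < 1] with a positive vector
    ([finite_capacity_root]), which serves for both bounds.  For infinite capacity a
    positive vector exists at [eta], where the characteristic equation has a double
    root, provided [eta <= lam / mu1], which follows from [mu1 <= mu2]; and at
    [lam / mu2] there is the vector [(mu2 / lam)^j].  Slightly below [eta] when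
    [mu1 <= mu2], or below [lam / mu2] when [mu2 < mu1], the solution of the
    recursion changes sign after finitely many phases
    ([phase_vec_sign_change]), which is what the lower bound needs.

    The matrix [H] is the increasing limit of a functional iteration, whence
    [H x <= h x].  Equality follows by comparing the defect [h x - H x] with the
    escape probabilities [1 - H 1] ([passage_mx_eigenvector]), and the positive
    eigenvector [x] makes [h] the maximal eigenvalue.

    The link with the process ([prob_first_visit]) is made through the jump chain:
    the probability of hitting a state within [n] jumps obeys a backward recursion,
    obtained from the probabilities of cylinders. *)

Set Implicit Arguments.
Unset Strict Implicit.
Unset Printing Implicit Defensive.

(** * Hitting probabilities of a Markov jump process *)

Section HittingProbability.
Context {R : realType} {S : countType}.
Variables (q : S -> S -> R) (succ : S -> seq S) (tgt : S) (B : pred S).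

(** The backward recursion conditions on the first jump, which lets functions on
    the state space be compared with hitting probabilities by induction on the
    number of jumps. *)
Fixpoint hit_within (n : nat) (x : S) : R :=
  if x == tgt then 1
  else if n is n'.+1 then
    (if B x then \sum_(y <- succ x) jump_prob q x y * hit_within n' y else 0)
  else 0.

Hypothesis succ_uniq : forall x, uniq (succ x).
Hypothesis q_succ : forall x y, y \notin succ x -> q x y = 0.
Hypothesis q_ge0 : forall x y, 0 <= q x y.
Hypothesis exit_gt0 : forall x, B x -> 0 < exit_rate q x.

Lemma exit_rateE x : exit_rate q x = \sum_(y <- succ x) q x y.
Proof.
rewrite /exit_rate (@fsbig_seq _ _ (GRing.add : Monoid.com_law 0) _ _ _ (succ_uniq x)).
apply/esym/fsbig_widen => // y [_ /= /negP]; exact: q_succ.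
Qed.

Lemma sum_jump_prob x : B x -> \sum_(y <- succ x) jump_prob q x y = 1.
Proof.
move=> Bx; rewrite -mulr_suml -exit_rateE divff// gt_eqF//; exact: exit_gt0.
Qed.

Lemma jump_prob_ge0 x y : 0 <= jump_prob q x y.
Proof.
rewrite /jump_prob divr_ge0// exit_rateE sumr_ge0//.
Qed.

Lemma hit_within_ge0 n x : 0 <= hit_within n x.
Proof.
elim: n x => [|n IHn] x /=; case: ifP => // _; case: ifP => // _.
by rewrite sumr_ge0// => y _; rewrite mulr_ge0// jump_prob_ge0.
Qed.

Lemma hit_within_le1 n x : hit_within n x <= 1.
Proof.
elim: n x => [|n IHn] x /=; case: ifP => // _; case: ifP => // Bx.
rewrite -[leRHS](sum_jump_prob Bx) ler_sum// => y _.
by rewrite ler_piMr// jump_prob_ge0.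
Qed.

Lemma hit_within_tgt n : hit_within n tgt = 1.
Proof. by case: n => [|n] /=; rewrite eqxx. Qed.

Lemma hit_within_nd x : nondecreasing_seq (hit_within ^~ x).
Proof.
apply/nondecreasing_seqP => n; elim: n x => [|n IHn] x.
  by rewrite /=; do 2?case: ifP => // _; rewrite sumr_ge0// => y _;
     rewrite mulr_ge0 ?jump_prob_ge0//; case: ifP.
rewrite [leLHS]/=; case: ifPn => [/eqP ->|xt]; first by rewrite hit_within_tgt.
case: ifPn => Bx; last exact: hit_within_ge0.
rewrite [leRHS]/= (negbTE xt) Bx ler_sum// => y _.
by rewrite ler_wpM2l// jump_prob_ge0.
Qed.

Definition hit_prob x : R := limn (hit_within ^~ x).

Lemma hit_within_cvg x : hit_within ^~ x @ \oo --> hit_prob x.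
Proof.
apply: (nondecreasing_is_cvgn (@hit_within_nd x)).
by exists 1 => _ [n _ <-]; exact: hit_within_le1.
Qed.

Lemma hit_within_le n x : hit_within n x <= hit_prob x.
Proof.
apply: nondecreasing_cvgn_le; first exact: hit_within_nd.
by apply: cvgP; exact: hit_within_cvg.
Qed.

Lemma hit_prob_ge0 x : 0 <= hit_prob x.
Proof. exact: le_trans (hit_within_ge0 0 x) (hit_within_le 0 x). Qed.

Lemma hit_prob_tgt : hit_prob tgt = 1.
Proof.
rewrite /hit_prob (_ : hit_within ^~ tgt = cst 1) ?lim_cst//.
by apply/funext => n; rewrite hit_within_tgt.
Qed.

Lemma hit_prob_superharmonic x : B x ->
  \sum_(y <- succ x) q x y * hit_prob y <= exit_rate q x * hit_prob x.
Proof.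
move=> Bx; have e0 := exit_gt0 Bx.
have [->|xt] := eqVneq x tgt.
  rewrite hit_prob_tgt mulr1 exit_rateE ler_sum// => y _.
  rewrite ler_piMr//; apply: limr_le; first by apply: cvgP; exact: hit_within_cvg.
  by apply: nearW => n; exact: hit_within_le1.
rewrite mulrC -ler_pdivrMr// mulr_suml.
have h : (fun n => \sum_(y <- succ x) jump_prob q x y * hit_within n y) @ \oo -->
    \sum_(y <- succ x) q x y * hit_prob y / exit_rate q x.
  apply: cvg_big => [|y _]; first exact: add_continuous.
  by rewrite mulrAC; apply: cvgMr; exact: hit_within_cvg.
apply: (cvgr_to_le h); apply: nearW => n.
by have := hit_within_le n.+1 x; rewrite /= (negbTE xt) Bx.
Qed.

(** Along the chain stopped at the target or outside [B], [F] is a nonnegative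
    supermartingale, so its initial value is at least its value at the target
    times the probability of being stopped there. *)
Lemma hit_prob_le_superharmonic (V : pred S) (F : S -> R) :
  (forall x, V x -> 0 <= F x) -> V tgt -> 0 < F tgt ->
  (forall x y, V x -> q x y != 0 -> V y) ->
  (forall x, V x -> B x -> \sum_(y <- succ x) q x y * F y <= exit_rate q x * F x) ->
  forall x, V x -> hit_prob x <= F x / F tgt.
Proof.
move=> F0 Vt Ft0 Vq Fs x Vx; apply: (cvgr_to_le (@hit_within_cvg x)).
apply: nearW => n; rewrite ler_pdivlMr//.
elim: n x Vx => [|n IHn] x Vx /=; case: ifPn => [/eqP ->|xt];
  rewrite ?mul1r ?mul0r ?F0//.
case: ifPn => Bx; last by rewrite mul0r F0.
have e0 := exit_gt0 Bx.
rewrite mulr_suml -(ler_pM2l e0) mulr_sumr (le_trans _ (Fs _ Vx Bx))//.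
apply: ler_sum => y _.
have [qy|qy] := eqVneq (q x y) 0.
  by rewrite /jump_prob qy !mul0r mulr0.
rewrite (_ : exit_rate q x * (jump_prob q x y * hit_within n y * F tgt) = q x y * (hit_within n y * F tgt)); last first.
  by rewrite /jump_prob; field; rewrite gt_eqF.
by rewrite ler_wpM2l// IHn// (Vq x).
Qed.

End HittingProbability.

Section JumpProcess.
Context {R : realType} {S : countType}.
Variables (q : S -> S -> R) (succ : S -> seq S) (tgt : S) (B : pred S).
Hypothesis succ_uniq : forall x, uniq (succ x).
Hypothesis q_succ : forall x y, y \notin succ x -> q x y = 0.
Hypothesis q_ge0 : forall x y, 0 <= q x y.
Hypothesis exit_gt0 : forall x, B x -> 0 < exit_rate q x.

Context {d : measure_display} {Om : measurableType d} (P : probability Om R).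
Variables (Z : nat -> Om -> S) (x0 : S).
Hypothesis mZ : forall n x, measurable (Z n @^-1` [set x]).

Definition cylinder (n : nat) (z : nat -> S) : set Om :=
  [set w | forall k, (k <= n)%N -> Z k w = z k].

Hypothesis cylinderE : forall n z,
  P (cylinder n z) = ((z 0%N == x0)%:R * \prod_(k < n) jump_prob q (z k) (z k.+1))%:E.

Lemma measurable_preimage n (A : set S) : measurable (Z n @^-1` A).
Proof.
rewrite (_ : Z n @^-1` A = \bigcup_x (Z n @^-1` ([set x] `&` A))).
  apply: countable_bigcupT_measurable => [|x]; first exact: countableP.
  have [Ax|nAx] := pselect (A x).
    rewrite (_ : _ `&` _ = [set x])//.
    by apply/seteqP; split => [y []|y ->].
  rewrite (_ : _ `&` _ = set0) ?preimage_set0//.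
  by apply/seteqP; split => [y [->]|//].
by apply/seteqP; split => [w Aw|w [x _ []]//]; exists (Z n w).
Qed.

Lemma measurable_cylinder n z : measurable (cylinder n z).
Proof.
rewrite (_ : cylinder n z = \bigcap_(k in `I_n.+1) (Z k @^-1` [set z k])).
  by apply: bigcap_measurable => [|k _]; [exists 0%N|exact: mZ].
by apply/seteqP; split => w h k; exact: h.
Qed.

(** Recursive rather than a bounded quantification over times, to match
    [hit_within] jump by jump. *)
Fixpoint hits (n N : nat) (w : Om) : Prop :=
  Z N w = tgt \/ (if n is n'.+1 then B (Z N w) /\ hits n' N.+1 w else False).

Lemma measurable_hits n N : measurable [set w | hits n N w].
Proof.
elim: n N => [|n IHn] N.
  rewrite (_ : mkset _ = Z N @^-1` [set tgt])//.
  by apply/seteqP; split => [w []|w] //=; left.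
rewrite (_ : mkset _ = Z N @^-1` [set tgt] `|`
   (Z N @^-1` [set` B] `&` [set w | hits n N.+1 w]))//.
by apply: measurableU => //; apply: measurableI => //; exact: measurable_preimage.
Qed.

Lemma split_on_values (A : set Om) n (s : seq S) : measurable A -> uniq s ->
  (P A = \sum_(y <- s) P (A `&` Z n @^-1` [set y]) +
    P (A `&` Z n @^-1` [set y | y \notin s]))%E.
Proof.
move=> mA; elim: s => [|y s IHs]/=.
  rewrite big_nil add0e (_ : _ @^-1` _ = setT) ?setIT//.
  by apply/seteqP.
move=> /andP[ys us]; rewrite big_cons IHs// -addeA addeCA; congr (_ + _)%E.
have mB := @measurable_preimage n [set y]; have mC := @measurable_preimage n.
rewrite (@measureDI _ _ _ P (A `&` Z n @^-1` [set y | y \notin s]) (Z n @^-1` [set y]))//;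
   last exact: measurableI.
rewrite addeC; congr (P _ + P _)%E; apply/seteqP; split => w /=.
- move=> [[Aw ws] ny]; split => //; rewrite inE negb_or ws andbT.
  by apply/eqP => e; apply: ny.
- by rewrite inE negb_or => -[? /andP[/eqP ? ?]]; split.
- by move=> [[? _] ?].
- by move=> [? e]; split => //; split => //; rewrite e.
Qed.

Definition extend (z : nat -> S) N y k := if (k <= N)%N then z k else y.

Lemma cylinder_extend z N y :
  cylinder N z `&` Z N.+1 @^-1` [set y] = cylinder N.+1 (extend z N y).
Proof.
apply/seteqP; split => [w [h /= e] k|w h]; rewrite /extend.
  by rewrite leq_eqVlt ltnS => /orP[/eqP ->|kN]; rewrite ?ltnn// kN h.
split => [k kN|/=]; first by rewrite h ?leqW// /extend kN.
by rewrite h// /extend ltnn.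
Qed.

Lemma prob_cylinder_extend z N y :
  P (cylinder N.+1 (extend z N y)) = (P (cylinder N z) * (jump_prob q (z N) y)%:E)%E.
Proof.
rewrite !cylinderE -EFinM big_ord_recr /= mulrA; congr (_ * _ * _)%:E.
- by apply: eq_bigr => k _; rewrite /extend (ltnW (ltn_ord k)) (ltn_ord k).
- by rewrite /extend leqnn ltnn.
Qed.

(** The extensions of a cylinder by the listed successors already carry its whole
    probability, so no other state is visited next; this keeps all sums over the
    countable state space finite. *)
Lemma prob_cylinder_outside z N : B (z N) ->
  P (cylinder N z `&` Z N.+1 @^-1` [set y | y \notin succ (z N)]) = 0%E.
Proof.
move=> Bz; have := split_on_values N.+1 (measurable_cylinder N z) (succ_uniq (z N)).
under eq_bigr do rewrite cylinder_extend prob_cylinder_extend.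
have fc := fin_num_measure P _ (measurable_cylinder N z).
rewrite -ge0_sume_distrr; last first.
  by move=> y _; rewrite lee_fin (jump_prob_ge0 succ_uniq q_succ q_ge0).
rewrite sumEFin (sum_jump_prob succ_uniq q_succ exit_gt0)// mule1 => e.
apply/eqP; have mr : measurable (cylinder N z `&` Z N.+1 @^-1` [set y | y \notin succ (z N)]).
  by apply: measurableI; [exact: measurable_cylinder|exact: measurable_preimage].
move: e; rewrite -(fineK fc) -(fineK (fin_num_measure P _ mr)) -EFinD => -[].
by move=> /eqP; rewrite -[eqbLHS]addr0 => /eqP/addrI <-.
Qed.

(** The Markov property, in the only form used below: given a trajectory up to
    step [N], the future hits the target as from a fresh start at [z N]. *)
Lemma prob_cylinder_hits n N z :
  P (cylinder N z `&` [set w | hits n N w]) =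
  (P (cylinder N z) * (hit_within q succ tgt B n (z N))%:E)%E.
Proof.
have mH := measurable_hits; have mC := measurable_cylinder.
elim: n N z => [|n IHn] N z /=; case: ifPn => [/eqP zt|zt].
1,3: rewrite mule1; congr (P _); apply/seteqP; split => [w []//|w h]; split => //=;
  by left; rewrite h.
- rewrite mule0 (_ : _ `&` _ = set0) ?measure0//.
  apply/seteqP; split => // w [h /= [|//]].
  by rewrite h// => zt'; rewrite zt' eqxx in zt.
case: ifPn => Bz; last first.
  rewrite mule0 (_ : _ `&` _ = set0) ?measure0//.
  apply/seteqP; split => // w [h /=]; rewrite h// => -[zt'|[Bz' _]].
    by rewrite zt' eqxx in zt.
  by rewrite Bz' in Bz.
set C := cylinder N z `&` [set w | hits n N.+1 w].
rewrite (_ : _ `&` _ = C); last first.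
  apply/seteqP; split => w [h /=]; rewrite ?h// => hh; split => //=.
    by case: hh => [e|[]//]; rewrite e eqxx in zt.
  by right.
have mC' : measurable C by exact: measurableI.
rewrite (split_on_values N.+1 mC' (succ_uniq (z N))).
rewrite [X in (_ + X)%E](_ : _ = 0%E) ?adde0; last first.
  apply/eqP; rewrite -measure_le0 -(prob_cylinder_outside Bz).
  apply: le_measure; rewrite ?inE.
  - by apply: measurableI => //; exact: measurable_preimage.
  - by apply: measurableI => //; exact: measurable_preimage.
  - by move=> w [[]].
have step y : P (C `&` Z N.+1 @^-1` [set y]) = (P (cylinder N z) *
    (jump_prob q (z N) y * hit_within q succ tgt B n y)%:E)%E.
  rewrite (_ : C `&` _ = cylinder N.+1 (extend z N y) `&` [set w | hits n N.+1 w]).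
    rewrite IHn prob_cylinder_extend -muleA -EFinM.
    by rewrite /extend ltnn.
  by rewrite -cylinder_extend /C setIAC.
rewrite (eq_bigr _ (fun y _ => step y)).
rewrite -ge0_sume_distrr ?sumEFin// => y _.
by rewrite lee_fin mulr_ge0 ?(jump_prob_ge0 succ_uniq q_succ q_ge0) ?(hit_within_ge0 _ _ succ_uniq q_succ q_ge0).
Qed.

Lemma prob_hits n : P [set w | hits n 0 w] = (hit_within q succ tgt B n x0)%:E.
Proof.
have mH := measurable_hits; have mC := measurable_cylinder.
have P1 : P (cylinder 0 (fun=> x0)) = 1%E by rewrite cylinderE big_ord0 eqxx mulr1.
have -> : P [set w | hits n 0 w] = P (cylinder 0 (fun=> x0) `&` [set w | hits n 0 w]).
  rewrite (@measureDI _ _ _ P _ (cylinder 0 (fun=> x0)))// setIC.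
  rewrite [X in (X + _)%E](_ : _ = 0%E) ?add0e//.
  apply/eqP; rewrite -measure_le0 -(_ : P (~` cylinder 0 (fun=> x0)) = 0%E).
    apply: le_measure; rewrite ?inE.
    - exact: measurableD.
    - exact: measurableC.
    - by move=> w [].
  by rewrite probability_setC// P1 subee.
by rewrite prob_cylinder_hits P1 mul1e.
Qed.

Lemma prob_bigcup_hits :
  fine (P (\bigcup_n [set w | hits n 0 w])) = hit_prob q succ tgt B x0.
Proof.
have mH := measurable_hits.
have mU : measurable (\bigcup_n [set w | hits n 0 w]) by exact: bigcup_measurable.
have nd : nondecreasing_seq (fun n => [set w | hits n 0 w]).
  apply/nondecreasing_seqP => n; apply/subsetPset => w.
  move: (0%N); elim: n => [|n IHn] N /=.
    by case=> // ->; left.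
  by case=> [|[? /IHn ?]]; [left|right].
have h := @hit_within_cvg _ _ _ _ tgt _ succ_uniq q_succ q_ge0 exit_gt0 x0.
have := nondecreasing_cvg_mu (mu := P) (fun n => mH n 0) mU nd.
under eq_cvg do rewrite /= prob_hits.
move/cvg_lim => <-//; rewrite -[RHS]/(fine (hit_prob q succ tgt B x0)%:E).
by congr fine; apply: cvg_lim => //; apply/fine_cvgP; split; first exact: nearW.
Qed.

End JumpProcess.

(** ** From continuous time to the jump chain *)

Section JumpTimes.
Context {R : realType} {Om S : Type}.
Variables (X : R -> Om -> S) (Z : nat -> Om -> S) (E : nat -> Om -> R).
Hypothesis E_gt0 : forall n w, 0 < E n w.
Hypothesis X_steps : forall t w, 0 <= t -> exists n,
  [/\ \sum_(k < n) E k w <= t, t < \sum_(k < n.+1) E k w & X t w = Z n w].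

Lemma jump_time_ge0 n w : 0 <= \sum_(k < n) E k w.
Proof. by apply: sumr_ge0 => k _; exact: ltW. Qed.

Lemma jump_time_mono w m n : (\sum_(k < m) E k w < \sum_(k < n) E k w) -> (m < n)%N.
Proof.
apply: contraTT; rewrite -leqNgt -leNgt => nm.
rewrite -!(big_mkord xpredT (fun k => E k w)) (big_cat_nat (leq0n n) nm)/= lerDl.
by apply: sumr_ge0 => k _; exact: ltW.
Qed.

Lemma jump_time_lt w m n : (m < n)%N -> \sum_(k < m) E k w < \sum_(k < n) E k w.
Proof.
move=> mn; apply: (@lt_le_trans _ _ (\sum_(k < m.+1) E k w)).
  by rewrite big_ord_recr/= ltrDl.
rewrite leNgt; apply/negP => /jump_time_mono; by rewrite ltnS leqNgt mn.
Qed.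

Lemma at_jump_time n w : X (\sum_(k < n) E k w) w = Z n w.
Proof.
have [m [le lt ->]] := X_steps w (jump_time_ge0 n w).
congr (Z _ w); apply/eqP; rewrite eqn_leq -[(n <= m)%N]ltnS (jump_time_mono lt).
by rewrite andbT leqNgt; apply/negP => /(jump_time_lt w); rewrite ltNge le.
Qed.

(** Holding times are positive, so the states occupied before the time of the
    first visit are exactly the states visited by the jump chain before it. *)
Lemma first_visit_jump_chain (tgt : S) (B : S -> Prop) w :
  (exists t : R, [/\ 0 <= t, X t w = tgt & forall s, 0 <= s -> s < t -> B (X s w)])
  <-> exists n, Z n w = tgt /\ forall k, (k < n)%N -> B (Z k w).
Proof.
split=> [[t [t0 Xt Bt]]|[n [Zn Bn]]].
  have [n [le lt e]] := X_steps w t0.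
  exists n; split; first by rewrite -e.
  move=> k kn; rewrite -at_jump_time; apply: Bt; first exact: jump_time_ge0.
  exact: lt_le_trans (jump_time_lt w kn) le.
exists (\sum_(k < n) E k w); split; first exact: jump_time_ge0.
  by rewrite at_jump_time.
move=> s s0 sn; have [m [le lt ->]] := X_steps w s0; apply: Bn.
exact: jump_time_mono (le_lt_trans le sn).
Qed.

End JumpTimes.

Lemma prob_first_visit {R : realType} {S : countType}
    (q : S -> S -> R) (succ : S -> seq S) (tgt : S) (B : pred S)
    (succ_uniq : forall x, uniq (succ x))
    (q_succ : forall x y, y \notin succ x -> q x y = 0)
    (q_ge0 : forall x y, 0 <= q x y)
    (exit_gt0 : forall x, B x -> 0 < exit_rate q x)
    (d : measure_display) (Om : measurableType d) (P : probability Om R)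
    (x0 : S) (X : R -> Om -> S) :
  markov_jump_process P q x0 X ->
  fine (P [set w | exists t : R, [/\ 0 <= t, X t w = tgt &
                     forall s, 0 <= s -> s < t -> B (X s w)]])
  = hit_prob q succ tgt B x0.
Proof.
move=> [Z [E [mZ mE E0 XZ law]]].
have cylE n z : P (cylinder Z n z) =
    ((z 0%N == x0)%:R * \prod_(k < n) jump_prob q (z k) (z k.+1))%:E.
  have := law n z (fun=> 0) (fun=> lexx 0).
  rewrite [X in _ * X]big1 ?mulr1 => [<-|k _]; last by rewrite mulr0 oppr0 expR0.
  congr (P _); apply/seteqP; split => w h k kn; first by split; [exact: h|].
  by case: (h k kn).
rewrite -(prob_bigcup_hits tgt succ_uniq q_succ q_ge0 exit_gt0 mZ cylE).
have fv := @first_visit_jump_chain R Om S X Z E E0 XZ tgt (fun x => B x).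
congr (fine (P _)); apply/seteqP; split => w /=.
- move=> /fv.
  move=> [n [Zn Bn]]; exists n => //=.
  have : Z (0 + n)%N w = tgt by [].
  have : forall k, (k < n)%N -> B (Z (0 + k)%N w) by [].
  move: (0%N) => N {Zn Bn}; elim: n N => [|n IHn] N Bn Zn /=.
    by left; rewrite addn0 in Zn.
  right; split; first by have := Bn 0%N isT; rewrite addn0.
  apply: IHn => [k kn|]; last by rewrite addSnnS.
  by rewrite addSnnS; exact: Bn.
- move=> [n _ hn].
  apply/fv.
  suff [m [Zm Bm]] : exists m, Z (0 + m)%N w = tgt /\
    forall k, (k < m)%N -> B (Z (0 + k)%N w) by exists m.
  move: (0%N) hn; elim: n => [|n IHn] N /=.
    by case=> // Zt; exists 0%N; split => //; rewrite addn0.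
  case=> [Zt|[BN /IHn [m [Zm Bm]]]].
    by exists 0%N; split => //; rewrite addn0.
  exists m.+1; split; first by rewrite -addSnnS.
  case=> [|k] km; first by rewrite addn0.
  by rewrite -addSnnS; exact: Bm.
Qed.

(** * The tandem network: super- and subharmonic functions *)

Definition tandem_succ (x : nat * nat) : seq (nat * nat) :=
  [:: (x.1, x.2.+1); (x.1.+1, x.2.-1); (x.1.-1, x.2)].

Definition interior (K : nat) (x : nat * nat) : bool :=
  (x.1 != 0%N) && (x.1 != K).

Definition phase_ok (cap : option nat) (j : nat) : bool :=
  if cap is Some m then (j <= m)%N else true.

Lemma below_phase_ok cap j : below_capacity cap j = phase_ok cap j.+1.
Proof. by case: cap. Qed.

Lemma phase_okS cap j : phase_ok cap j.+1 -> phase_ok cap j.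
Proof. by case: cap => // m /ltnW. Qed.

Lemma phase_ok_le cap i j : (i <= j)%N -> phase_ok cap j -> phase_ok cap i.
Proof. by case: cap => // m; exact: leq_trans. Qed.

Section Tandem.
Context {R : realType}.
Variables (lam mu1 mu2 : R) (cap : option nat).
Hypotheses (lam_gt0 : 0 < lam) (mu1_gt0 : 0 < mu1) (mu2_gt0 : 0 < mu2).

Local Notation rate := (tandem_rate lam mu1 mu2 cap).

Definition arrival_rate j := if below_capacity cap j then lam else 0.
Definition service_rate (j : nat) := if (0 < j)%N then mu1 else 0.

Lemma arrival_rate_ge0 j : 0 <= arrival_rate j.
Proof. by rewrite /arrival_rate; case: ifP => // _; exact: ltW. Qed.

Lemma service_rate_ge0 j : 0 <= service_rate j.
Proof. by rewrite /service_rate; case: ifP => // _; exact: ltW. Qed.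

Lemma tandem_succ_uniq x : uniq (tandem_succ x).
Proof.
case: x => k j; rewrite /= !inE !xpair_eqE negb_or.
by apply/and3P; split => //; [apply/andP; split|]; apply/negP; lia.
Qed.

Lemma tandem_rate_succ x y : y \notin tandem_succ x -> rate x y = 0.
Proof.
case: x => k j; rewrite /= !inE !negb_or => /and3P[/negbTE y1 /negbTE y2 /negbTE y3].
by rewrite y1 y2 y3 !andbF.
Qed.

Lemma tandem_rate_ge0 x y : 0 <= rate x y.
Proof. by case: x => k j /=; do 3?case: ifP => // _; exact: ltW. Qed.

Lemma sum_tandem_rate (F : nat * nat -> R) k j :
  \sum_(y <- tandem_succ (k.+1, j)) rate (k.+1, j) y * F y =
  arrival_rate j * F (k.+1, j.+1) + service_rate j * F (k.+2, j.-1)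
    + mu2 * F (k, j).
Proof.
rewrite /tandem_succ !big_cons big_nil addr0 /= !xpair_eqE !eqxx /=.
rewrite addrA /arrival_rate /service_rate; congr (_ * _ + _ * _ + _ * _).
- by rewrite andbT; case: ifP => // _; rewrite !ifF//; apply/negP; lia.
- by rewrite andbT ifF//; [|apply/negP; lia]; case: ifP => // _; rewrite ifF//; lia.
- by rewrite !ifF//; apply/negP; lia.
Qed.

Lemma tandem_exit_rate k j :
  exit_rate rate (k.+1, j) = arrival_rate j + service_rate j + mu2.
Proof.
rewrite (exit_rateE tandem_succ_uniq tandem_rate_succ).
under eq_bigr do rewrite -[rate _ _]mulr1.
by rewrite (sum_tandem_rate (fun=> 1)) !mulr1.
Qed.

Lemma tandem_exit_gt0 K x : interior K x -> 0 < exit_rate rate x.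
Proof.
case: x => -[|k] j // _; rewrite tandem_exit_rate ltr_wpDl//.
by rewrite addr_ge0// (arrival_rate_ge0,service_rate_ge0).
Qed.

Definition upcross (K j : nat) : nat * nat -> R :=
  hit_prob rate tandem_succ (K, j) (interior K).

Lemma reach_probE (d : measure_display) (Om : measurableType d)
    (P : probability Om R) (X : R -> Om -> nat * nat) x0 K j :
  markov_jump_process P rate x0 X -> reach_prob P X K j = upcross K j x0.
Proof.
move=> XP.
rewrite /upcross -(prob_first_visit (K, j) tandem_succ_uniq tandem_rate_succ tandem_rate_ge0 (@tandem_exit_gt0 K) XP).
congr (fine (P _)); apply/seteqP; split => w [t [t0 Xt h]]; exists t; split => // s s0 st.
  by have [/eqP a /eqP b] := h s s0 st; rewrite /interior a b.
by have /andP[/eqP a /eqP b] := h s s0 st.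
Qed.

(** ** Functions of product form *)

(** This is [Q0 + z Q1 + z^2 Q2] applied to the phase vector [x] and divided by
    [z], written so that it makes sense for infinite capacity as well. *)
Definition phase_op (z : R) (x : nat -> R) (j : nat) : R :=
  arrival_rate j * (x j.+1 - x j) + service_rate j * (x j.-1 / z - x j)
    - mu2 * (1 - z) * x j.

(** The function [x_j / z^k] of the state [(k, j)] is thus super-, sub- or exactly
    harmonic for the network according to the sign of [phase_op z x]. *)
Lemma phase_opE z x k j : z != 0 ->
  arrival_rate j * (x j.+1 / z ^+ k.+1) + service_rate j * (x j.-1 / z ^+ k.+2)
    + mu2 * (x j / z ^+ k) =
  (arrival_rate j + service_rate j + mu2) * (x j / z ^+ k.+1)
    + phase_op z x j / z ^+ k.+1.
Proof.
move=> z0; rewrite /phase_op !exprS; field.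
by rewrite z0 expf_neq0.
Qed.

Lemma upcross_le z x K i j : (0 < K)%N -> 0 < z ->
  (forall l, phase_ok cap l -> 0 < x l) ->
  (forall l, phase_ok cap l -> phase_op z x l <= 0) ->
  phase_ok cap i -> phase_ok cap j ->
  upcross K j (1%N, i) <= x i / x j / z * z ^+ K.
Proof.
move=> K0 z0 x0 opx oki okj; have z1 := lt0r_neq0 z0.
have zk0 k : 0 < z ^+ k by exact: exprn_gt0.
pose F (y : nat * nat) := x y.2 / z ^+ y.1.
rewrite (_ : _ * z ^+ K = F (1%N, i) / F (K, j)); last first.
  by rewrite /F /= expr1; field; rewrite ?z1 ?(gt_eqF (x0 _ okj)) ?gt_eqF.
apply: (@hit_prob_le_superharmonic _ _ rate _ _ _ tandem_succ_uniq tandem_rate_succ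
  tandem_rate_ge0 (@tandem_exit_gt0 K) (fun y => phase_ok cap y.2) F) => //.
- by move=> y oky; rewrite /F divr_ge0 ?ltW// x0.
- by rewrite /F divr_gt0// x0.
- move=> [k l] y okl /=; case: ifPn => [/andP[]|_].
    by rewrite below_phase_ok => okl1 /eqP ->.
  case: ifPn => [/andP[_ /eqP ->] _|_]; first by apply: phase_ok_le okl; exact: leq_pred.
  by case: ifPn => [/andP[_ /eqP ->]|_]//; rewrite eqxx.
- move=> [[|k] l] //= okl _; rewrite sum_tandem_rate tandem_exit_rate phase_opE//=.
  by rewrite gerDl pmulr_lle0 ?invr_gt0// opx.
Qed.

(** Minimum principle: a service at the second queue leads one level down and
    stays in the box, so that a negative least value would propagate to level 0.
    Leaving the box through the phase [n + 1] is only possible below capacity. *)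
Lemma box_nonneg L n (v : nat -> nat -> R) :
  (forall j, (j <= n)%N -> 0 <= v 0%N j) ->
  (forall j, (j <= n)%N -> 0 <= v L j) ->
  (forall k, below_capacity cap n -> 0 <= v k n.+1) ->
  (forall k j, (k.+1 < L)%N -> (j <= n)%N ->
     arrival_rate j * v k.+1 j.+1 + service_rate j * v k.+2 j.-1 + mu2 * v k j
     <= (arrival_rate j + service_rate j + mu2) * v k.+1 j) ->
  forall k j, (k < L)%N -> (j <= n)%N -> 0 <= v k j.
Proof.
move=> v0 vL vn vs k0 j0 k0L j0n; rewrite leNgt; apply/negP => neg.
case: (@Order.TotalTheory.arg_minP _ _ _ (Ordinal k0L, Ordinal (j0n : (j0 < n.+1)%N)) xpredT
  (fun p : 'I_L * 'I_n.+1 => v p.1 p.2) isT) => -[/= km jm] _.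
set mu := v km jm => min_mu.
have mu_le k j : (k < L)%N -> (j <= n)%N -> mu <= v k j.
  move=> kL jn; exact: (min_mu (Ordinal kL, Ordinal (jn : (j < n.+1)%N)) isT).
have mu_lt0 : mu < 0 by exact: le_lt_trans (mu_le _ _ k0L j0n) neg.
have mu_up k j : (k <= L)%N -> (j <= n)%N -> mu <= v k j.
  rewrite leq_eqVlt => /orP[/eqP ->|] jn; last exact: mu_le.
  by rewrite (le_trans (ltW mu_lt0))// vL.
suff mu_neq k j : (k < L)%N -> (j <= n)%N -> v k j != mu.
  by move: (mu_neq km jm (ltn_ord km)); rewrite -ltnS ltn_ord eqxx => /(_ isT).
elim: k j => [|k IHk] j kL jn.
  by rewrite gt_eqF// (lt_le_trans mu_lt0)// v0.
apply/eqP => vkj; have := vs _ _ kL jn; apply/negP; rewrite -ltNge vkj.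
rewrite !mulrDl ler_ltD//.
  rewrite lerD//.
    rewrite /arrival_rate; case: ifP => // bj; last by rewrite !mul0r.
    rewrite ler_pM2l//; move: jn; rewrite leq_eqVlt => /orP[/eqP jn|jn]; last exact: mu_up (ltnW kL) _.
    by rewrite (le_trans (ltW mu_lt0))// jn vn// -jn.
  by rewrite ler_wpM2l ?service_rate_ge0// mu_up// (leq_trans (leq_pred _)).
by rewrite ltr_pM2l// lt_neqAle eq_sym IHk ?mu_le// ltnW.
Qed.

Local Notation total := (lam + mu1 + mu2).

(** A lower bound, uniform in the state, for the jump probabilities of arrivals
    and of services at the first queue. *)
Definition step_bound : R := Num.min lam mu1 / total.

Lemma step_bound_gt0 : 0 < step_bound.
Proof. by rewrite divr_gt0 ?addr_gt0// lt_min lam_gt0. Qed.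

Lemma step_bound_le1 : step_bound <= 1.
Proof.
rewrite ler_pdivrMr ?addr_gt0// mul1r ge_min; apply/orP; left.
by rewrite -addrA lerDl addr_ge0// ltW.
Qed.

Lemma upcross_ge0 K j x : 0 <= upcross K j x.
Proof. exact: (@hit_prob_ge0 _ _ _ _ (K, j) _ tandem_succ_uniq tandem_rate_succ tandem_rate_ge0 (@tandem_exit_gt0 K)). Qed.

Lemma upcross_superharmonic K jt k j : k.+1 != K ->
  arrival_rate j * upcross K jt (k.+1, j.+1)
    + service_rate j * upcross K jt (k.+2, j.-1) + mu2 * upcross K jt (k, j)
  <= (arrival_rate j + service_rate j + mu2) * upcross K jt (k.+1, j).
Proof.
move=> kK; rewrite -sum_tandem_rate -(tandem_exit_rate k).
exact: (@hit_prob_superharmonic _ _ _ _ (K, jt) _ tandem_succ_uniq tandem_rate_succ tandem_rate_ge0 (@tandem_exit_gt0 K)).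
Qed.

Lemma upcross_arrival K jt k j : k.+1 != K -> phase_ok cap j.+1 ->
  step_bound * upcross K jt (k.+1, j.+1) <= upcross K jt (k.+1, j).
Proof.
move=> kK okj; have := upcross_superharmonic jt j kK.
rewrite {1}/arrival_rate below_phase_ok okj.
have u0 := upcross_ge0 K jt.
have s0 := service_rate_ge0 j; have s1 : service_rate j <= mu1.
  by rewrite /service_rate; case: ifP => // _; exact: ltW.
have a1 : arrival_rate j = lam by rewrite /arrival_rate below_phase_ok okj.
rewrite a1 /step_bound => h.
rewrite mulrAC ler_pdivrMr ?addr_gt0//.
apply: (@le_trans _ _ (lam * upcross K jt (k.+1, j.+1))).
  by rewrite ler_wpM2r// ge_min lexx.
have := ler_wpM2r (u0 (k.+1, j)) s1.
have := mulr_ge0 s0 (u0 (k.+2, j.-1)); have := mulr_ge0 (ltW mu2_gt0) (u0 (k, j)).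
by lra.
Qed.

Lemma upcross_service K jt k j : k.+1 != K ->
  step_bound * upcross K jt (k.+2, j) <= upcross K jt (k.+1, j.+1).
Proof.
move=> kK; have := upcross_superharmonic jt j.+1 kK.
have u0 := upcross_ge0 K jt.
have s0 := arrival_rate_ge0 j.+1; have s1 : arrival_rate j.+1 <= lam.
  by rewrite /arrival_rate; case: ifP => // _; exact: ltW.
rewrite /service_rate /= /step_bound => h.
rewrite mulrAC ler_pdivrMr ?addr_gt0//.
apply: (@le_trans _ _ (mu1 * upcross K jt (k.+2, j))).
  by rewrite ler_wpM2r// ge_min lexx orbT.
have := ler_wpM2r (u0 (k.+1, j.+1)) s1.
have := mulr_ge0 s0 (u0 (k.+1, j.+2)); have := mulr_ge0 (ltW mu2_gt0) (u0 (k, j.+1)).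
by lra.
Qed.

Lemma upcross_drain K jt k j : (k.+1 + j <= K)%N ->
  step_bound ^+ j * upcross K jt (k.+1 + j, 0)%N <= upcross K jt (k.+1, j).
Proof.
elim: j k => [|j IHj] k kK; first by rewrite addn0 mul1r.
apply: le_trans (upcross_service jt j _); last by lia.
rewrite exprS -mulrA -addSnnS ler_wpM2l ?(ltW step_bound_gt0)// IHj//; lia.
Qed.

Lemma upcross_climb K jt k n : phase_ok cap 1 -> (k.+1 + n <= K)%N ->
  step_bound ^+ (n.*2) * upcross K jt (k.+1 + n, 0)%N <= upcross K jt (k.+1, 0%N).
Proof.
move=> ok1; elim: n k => [|n IHn] k kK; first by rewrite addn0 mul1r.
have kK' : k.+1 != K by lia.
apply: le_trans (upcross_arrival jt kK' ok1).
rewrite doubleS !exprS -mulrA ler_wpM2l ?(ltW step_bound_gt0)//.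
apply: le_trans (upcross_service jt 0 kK').
rewrite -mulrA -addSnnS ler_wpM2l ?(ltW step_bound_gt0)// IHn//; lia.
Qed.

Lemma upcross_fill K jt k j : phase_ok cap j -> k.+1 != K ->
  step_bound ^+ j * upcross K jt (k.+1, j) <= upcross K jt (k.+1, 0%N).
Proof.
move=> okj kK; elim: j okj => [|j IHj] okj; first by rewrite mul1r.
apply: le_trans (IHj (phase_okS okj)).
rewrite exprSr -mulrA ler_wpM2l ?exprn_ge0 ?(ltW step_bound_gt0)//.
exact: upcross_arrival.
Qed.

(** Drain the first queue, climb by letting customers pass one at a time, then
    fill the first queue so that the last upward step ends in the wanted phase.
    The number of jumps, hence the bound, does not depend on the level. *)
Lemma upcross_near K jt k j d : phase_ok cap jt.+1 -> (j <= d)%N ->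
  (k.+2 + d = K)%N ->
  step_bound ^+ (d.*2 + jt.+2) <= upcross K jt (k.+1, j).
Proof.
move=> okj jd kdK; have s0 := step_bound_gt0.
apply: le_trans (upcross_drain jt (k := k) (j := j) _); last by lia.
have ok1 : phase_ok cap 1 by apply: phase_ok_le okj.
have e : (k.+1 + j = (k + j).+1)%N by [].
apply: (@le_trans _ _ (step_bound ^+ j * (step_bound ^+ (d - j).*2 * step_bound ^+ jt.+2))).
  rewrite -!exprD ler_wiXn2l ?(ltW s0) ?step_bound_le1//; lia.
rewrite ler_wpM2l ?exprn_ge0 ?(ltW s0)//.
apply: le_trans (upcross_climb (k := k + j) jt (n := d - j) ok1 _); last by lia.
rewrite ler_wpM2l ?exprn_ge0 ?(ltW s0)//.
have -> : ((k + j).+1 + (d - j) = (k + d).+1)%N by lia.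
have kK : (k + d).+1 != K by lia.
apply: le_trans (upcross_fill jt okj kK).
rewrite exprSr ler_wpM2l ?exprn_ge0 ?(ltW s0)//.
apply: le_trans (upcross_service jt jt kK).
rewrite (_ : (k + d).+2 = K) ?[upcross _ _ _]hit_prob_tgt ?mulr1//; lia.
Qed.

Let levels_below i k0 n K : (i <= k0)%N -> (k0.+2 + n.+1 <= K)%N -> exists L,
  [/\ K = (L.+2 + n)%N, (k0.+1 < L.+1)%N, (L.+1 <= K)%N,
      (1 + i <= K)%N /\ (i.+1 + (k0 - i) <= K)%N & forall k, (k.+1 < L.+1)%N -> k.+1 != K].
Proof. by move=> ik0 kK; exists (K - n.+2)%N; split => [|||| k kL]; lia. Qed.

(** The function [x_j / z^k - C], with [C] the sum of the [x_j], is subharmonic on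
    the box of phases at most [n], nonpositive at level 0 and at phase [n + 1], and
    at most [C / z^L] at a level [L] just below the target, where the hitting
    probability is bounded below.  The minimum principle then bounds the hitting
    probability in the whole box by a multiple of [z^L (x_j / z^k - C)], and as
    [z < 1] the second factor is at least 1 from some fixed level on. *)
Lemma upcross_ge z x n i jt : 0 < z < 1 -> phase_ok cap n ->
  (forall j, (j <= n)%N -> 0 < x j) ->
  (below_capacity cap n -> x n.+1 <= 0) ->
  (forall j, (j <= n)%N -> 0 <= phase_op z x j) ->
  phase_ok cap i -> phase_ok cap jt.+1 ->
  exists2 c, 0 < c & exists K0, forall K, (K0 <= K)%N ->
    c * z ^+ K <= upcross K jt (1%N, i).
Proof.
move=> /andP[z0 z1] okn x0 xn opx oki okjt; have zn0 := lt0r_neq0 z0.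
have zk0 k : 0 < z ^+ k by exact: exprn_gt0.
have s0 := step_bound_gt0; have sk0 k : 0 < step_bound ^+ k by exact: exprn_gt0.
pose C := \sum_(l < n.+1) x l.
have xC j : (j <= n)%N -> x j <= C.
  move=> jn; rewrite /C (bigD1 (Ordinal (jn : (j < n.+1)%N)))//= lerDl.
  by apply: sumr_ge0 => l _; rewrite ltW// x0// -ltnS ltn_ord.
have C0 : 0 < C by apply: lt_le_trans (x0 0%N isT) (xC _ _).
(* the starting level, where the subharmonic function has become at least 1 *)
have [k0 ik0 zk0s] : exists2 k0, (i <= k0)%N & C + 1 <= x 0%N / z ^+ k0.+1.
  have e0 : 0 < x 0%N / (C + 1) by rewrite divr_gt0 ?x0// addr_gt0.
  have zlim : (fun k => z ^+ k) @ \oo --> (0 : R).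
    by apply: cvg_expr; rewrite ger0_norm ?ltW.
  have /cvgrPdist_lt/(_ _ e0)[N _ hN] := zlim.
  exists (maxn i N); first exact: leq_maxl.
  have := hN (maxn i N).+1; rewrite /= sub0r normrN gtr0_norm// => hz.
  rewrite ler_pdivlMr// mulrC -ler_pdivlMr ?addr_gt0// ltW// hz//.
  by rewrite leqW// leq_maxr.
pose c1 := step_bound ^+ (n.*2 + jt.+2).
pose c2 := step_bound ^+ (i + (k0 - i).*2).
exists (c2 * (c1 / C)); first by rewrite mulr_gt0 ?sk0// divr_gt0// sk0.
exists (k0.+2 + n.+1)%N => K K0K.
have [L [KE k0L LK [iK ik0K] kK]] := levels_below ik0 K0K.
pose eps := c1 * z ^+ L.+1 / C.
have eps0 : 0 < eps by rewrite divr_gt0// mulr_gt0// sk0.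
pose g k j := x j / z ^+ k - C.
pose v k j := upcross K jt (k, j) - eps * g k j.
have u0 := upcross_ge0 K jt.
have v_ge0 k j : g k j <= 0 -> 0 <= v k j.
  by move=> g0; rewrite subr_ge0 (le_trans _ (u0 _))// pmulr_rle0.
have key : 0 <= v k0.+1 0%N.
  apply: (@box_nonneg L.+1 n v) => //.
  - by move=> j jn; rewrite v_ge0// /g expr0 divr1 subr_le0 xC.
  - move=> j jn; rewrite subr_ge0.
    apply: (@le_trans _ _ c1); last by exact: upcross_near.
    rewrite -[leRHS](_ : eps * (C / z ^+ L.+1) = c1); last first.
      by rewrite /eps; field; rewrite !gt_eqF.
    rewrite ler_pM2l// /g (@le_trans _ _ (x j / z ^+ L.+1))//.
      by rewrite gerBl ltW.
    by rewrite ler_pM2r ?invr_gt0// xC.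
  - move=> k bn; rewrite v_ge0// /g subr_le0 (le_trans _ (ltW C0))//.
    by rewrite pmulr_lle0 ?invr_gt0// xn.
  - move=> k j kL jn; rewrite /v.
    have := upcross_superharmonic jt j (kK k kL).
    have := phase_opE x k j zn0.
    have : 0 <= eps * (phase_op z x j / z ^+ k.+1).
      by rewrite mulr_ge0 ?(ltW eps0)// divr_ge0 ?opx// ltW.
    rewrite /g.
    set A := arrival_rate j; set S := service_rate j.
    set F1 := x j.+1 / _; set F2 := x j.-1 / _; set F3 := x j / z ^+ k.
    set F4 := x j / _; set PO := phase_op _ _ _ / _.
    set u1 := upcross _ _ (_, j.+1); set u2 := upcross _ _ (_, j.-1).
    set u3 := upcross _ _ (k, _); set u4 := upcross _ _ _.
    move=> po e su.
    have : eps * (A * F1 + S * F2 + mu2 * F3) = eps * ((A + S + mu2) * F4 + PO).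
      by rewrite e.
    by lra.
have big : c1 / C * z ^+ K <= upcross K jt (k0.+1, 0%N).
  apply: (@le_trans _ _ (eps * g k0.+1 0%N)); last by rewrite -subr_ge0.
  apply: (@le_trans _ _ eps).
    rewrite /eps mulrAC ler_pM2r ?invr_gt0// ler_pM2l ?sk0//.
    by rewrite ler_wiXn2l ?(ltW z0) ?(ltW z1).
  by rewrite ler_peMr ?(ltW eps0)// /g lerBrDl.
rewrite -mulrA /c2 exprD -mulrA.
have ok1 : phase_ok cap 1 by apply: phase_ok_le okjt.
apply: le_trans (upcross_drain jt (k := 0) (j := i) iK).
rewrite ler_pM2l ?sk0//.
apply: le_trans (upcross_climb (k := i) jt (n := k0 - i) ok1 ik0K).
by rewrite ler_pM2l ?sk0// addSn subnKC.
Qed.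

End Tandem.

(** * Logarithmic growth rates *)

Lemma cvg_ln_div_id (R : realType) (a : nat -> R) (z0 T : R) :
  0 <= z0 < T ->
  (exists2 C, 0 < C & exists K0, forall K, (K0 <= K)%N -> a K <= C * T ^+ K) ->
  (forall z, z0 < z < T ->
     exists2 c, 0 < c & exists K0, forall K, (K0 <= K)%N -> c * z ^+ K <= a K) ->
  ln (a K) / K%:R @[K --> \oo] --> ln T.
Proof.
move=> /andP[z00 z0T] [C C0 [K1 up]] low; have T0 := le_lt_trans z00 z0T.
apply/cvgrPdist_le => e e0.
(* an admissible rate whose logarithm is within [e / 2] of that of [T] *)
pose z := Num.max (T * expR (- (e / 2))) ((z0 + T) / 2).
have zT : z < T.
  rewrite gt_max; apply/andP; split; last by lra.
  by rewrite gtr_pMr// expR_lt1 oppr_lt0 divr_gt0.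
have z0z : z0 < z by rewrite lt_max; apply/orP; right; lra.
have zgt0 : 0 < z by exact: le_lt_trans z00 z0z.
have lnz : ln T - e / 2 <= ln z.
  rewrite -[leLHS]expRK expRD lnK// ler_ln ?posrE ?mulr_gt0 ?expR_gt0//.
  by rewrite /z le_max lexx.
have [|c c0 [K2 lo]] := low z; first by rewrite z0z.
near=> K.
have K0 : 0 < K%:R :> R by rewrite ltr0n; near: K; exact: nbhs_infty_gt.
have hK : (`|ln C| + `|ln c|) / (e / 2) <= K%:R by near: K; exact: nbhs_infty_ger.
have hup : a K <= C * T ^+ K by apply: up; near: K; exact: nbhs_infty_ge.
have hlo : c * z ^+ K <= a K by apply: lo; near: K; exact: nbhs_infty_ge.
have cz0 : 0 < c * z ^+ K by rewrite mulr_gt0// exprn_gt0.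
have a0 : 0 < a K by exact: lt_le_trans hlo.
have up' : ln (a K) <= ln C + K%:R * ln T.
  rewrite mulr_natl -lnXn// -lnM ?posrE ?exprn_gt0//.
  by rewrite ler_ln ?posrE// mulr_gt0// exprn_gt0.
have lo' : ln c + K%:R * ln z <= ln (a K).
  rewrite mulr_natl -lnXn// -lnM ?posrE ?exprn_gt0//.
  by rewrite ler_ln ?posrE.
have lnz' : K%:R * (ln T - e / 2) <= K%:R * ln z by rewrite ler_pM2l.
move: hK; rewrite ler_pdivrMr ?divr_gt0// => hK.
have nC := ler_norm (ln C); have nc := ler_norm (- ln c); rewrite normrN in nc.
have := normr_ge0 (ln C); have := normr_ge0 (ln c) => pc pC.
have eK : 0 <= K%:R * (e / 2) by rewrite mulr_ge0// ltW// divr_gt0.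
rewrite ler_distlC lerBlDr ler_pdivrMr// -lerBlDr ler_pdivlMr//.
by apply/andP; split; lra.
Unshelve. all: by end_near. Qed.

(** * The positive phase vector for finite capacity *)

Section PhaseRecursion.
Context {R : realType}.
Variables (lam mu1 mu2 : R).
Hypotheses (lam_gt0 : 0 < lam) (mu1_gt0 : 0 < mu1) (mu2_gt0 : 0 < mu2).

(** The solution [x] of [phase_op z x = 0] with [x_0 = 1] is computed as
    [x_j = X_j / z^j], which makes [X_j] a polynomial in [z].  The constant vector
    solves the equations at [z = 1]; accordingly [X_(j+1) - z X_j] has the factor
    [1 - z], and the second component [E_j] is the quotient. *)
Fixpoint phase_rec (z : R) (j : nat) : R * R :=
  if j is j'.+1 then
    let X := (phase_rec z j').1 in let E := (phase_rec z j').2 in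
    (z * X + (1 - z) * E,
     z * (mu1 * (E - X) + mu2 * (z * X + (1 - z) * E)) / lam)
  else (1, z * mu2 / lam).

Local Notation X z j := (phase_rec z j).1.
Local Notation E z j := (phase_rec z j).2.

Definition phase_vec z j := X z j / z ^+ j.

Lemma phase_recS z j : X z j.+1 = z * X z j + (1 - z) * E z j.
Proof. by []. Qed.

Lemma phase_rec1 z : lam * X z 1 = z * (lam + mu2 * (1 - z)).
Proof. by rewrite /=; field; rewrite gt_eqF. Qed.

Lemma phase_recSS z j :
  lam * X z j.+2 = z * ((lam + mu1 + mu2 * (1 - z)) * X z j.+1 - mu1 * X z j).
Proof. by rewrite /=; field; rewrite gt_eqF. Qed.

Lemma phase_vec_harmonic cap z j : z != 0 ->
  below_capacity cap j -> phase_op lam mu1 mu2 cap z (phase_vec z) j = 0.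
Proof.
move=> z0 bj; rewrite /phase_op /arrival_rate /service_rate bj /phase_vec.
have lam0 := lt0r_neq0 lam_gt0.
case: j bj => [|j] bj; rewrite ?ltnn ?ltn0Sn ?succnK.
  rewrite -[X z 0]/1 expr0 expr1.
  have -> : X z 1 = z * (lam + mu2 * (1 - z)) / lam.
    by rewrite -phase_rec1 mulrC mulKf.
  by field; rewrite z0 lam0.
have -> : X z j.+2 =
    z * ((lam + mu1 + mu2 * (1 - z)) * X z j.+1 - mu1 * X z j) / lam.
  by rewrite -phase_recSS mulrC mulKf.
move: (X z j.+1) (X z j) => a b; rewrite !exprS; field.
by rewrite z0 lam0 expf_neq0.
Qed.

(** At full capacity arrivals are lost, which amounts to [x_(m+1) = x_m]. *)
Lemma phase_vec_harmonic_top m z : z != 0 -> E z m.+1 = 0 ->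
  phase_op lam mu1 mu2 (Some m.+1) z (phase_vec z) m.+1 = 0.
Proof.
move=> z0 Em; have := phase_vec_harmonic z0 (isT : below_capacity None m.+1).
rewrite /phase_op /arrival_rate /= ltnn.
have -> : phase_vec z m.+2 = phase_vec z m.+1.
  by rewrite /phase_vec phase_recS Em mulr0 addr0 exprS invfM mulrACA divff// mul1r.
by rewrite subrr mulr0 mul0r.
Qed.

Lemma phase_rec_continuous j :
  continuous (fun z => X z j) /\ continuous (fun z => E z j).
Proof.
elim: j => [|j [cX cE]].
  split => z; first exact: cvg_cst.
  by apply: cvgMl; apply: cvgMl; exact: cvg_id.
have cX' : continuous (fun z => X z j.+1).
  move=> z; apply: cvgD; first by apply: cvgM; [exact: cvg_id|exact: cX].
  apply: cvgM; last exact: cE.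
  by apply: cvgB; [exact: cvg_cst|exact: cvg_id].
split => // z; apply: cvgMl; apply: cvgM; first exact: cvg_id.
apply: cvgD; apply: cvgMr; last exact: cX'.
by apply: cvgB; [exact: cE|exact: cX].
Qed.

Lemma phase_rec_at1 j : X 1 j = 1.
Proof.
by elim: j => //= j IHj; rewrite IHj subrr mul0r addr0 mul1r.
Qed.

Lemma phase_rec_slope j : (lam / mu1) ^+ j.+1 * E 1 j =
  1 + (mu2 / mu1 - 1) * \sum_(i < j.+1) (lam / mu1) ^+ i.
Proof.
have [l0 m0] := (lt0r_neq0 lam_gt0, lt0r_neq0 mu1_gt0).
elim: j => [|j IHj].
  by rewrite big_ord1 /= expr0 expr1; field; rewrite l0 m0.
rewrite [in RHS]big_ord_recr [in RHS]mulrDr [RHS]addrA -IHj /= phase_rec_at1 !exprS.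
move: (_ ^+ j) => r; rewrite subrr mul0r.
by field; rewrite l0 m0.
Qed.

(** The boundary condition [x_(m+1) - x_m] is a positive multiple of [(1 - z) E_m]:
    it vanishes at [z = 1], and stability says that it is positive just below 1. *)
Lemma stable_slope_gt0 m : (0 < m)%N -> stable lam mu1 mu2 m -> 0 < E 1 m.
Proof.
move=> m0 [st_ne st_eq]; set r := lam / mu1.
have r0 : 0 < r by rewrite divr_gt0.
rewrite -(@pmulr_rgt0 _ (r ^+ m.+1)) ?exprn_gt0// phase_rec_slope -/r.
pose S k := \sum_(i < k) r ^+ i.
have SS : S m.+1 = 1 + r * S m.
  rewrite /S big_ord_recl /= expr0 mulr_sumr; congr (_ + _).
  by apply: eq_bigr => i _; rewrite -exprS.
have Sm0 : 0 < S m.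
  case: (m) m0 => // m' _; rewrite /S big_ord_recl /= expr0 ltr_pwDl//.
  by apply: sumr_ge0 => i _; rewrite exprn_ge0// ltW.
have st : lam / mu2 * S m < S m.+1.
  rewrite -ltr_pdivlMr//; have [r1|r1] := eqVneq r 1.
    have Sk k : S k = k%:R.
      by rewrite /S r1; under eq_bigr do rewrite expr1n; rewrite sumr_const card_ord.
    rewrite !Sk (lt_le_trans (st_eq r1))// le_eqVlt; apply/orP; left; apply/eqP.
    by rewrite -natr1; field; rewrite pnatr_eq0 -lt0n.
  have Sk k : S k = (1 - r ^+ k) / (1 - r).
    rewrite -[1 - r ^+ k]opprB subrX1 -mulNr opprB mulrC mulKf// subr_eq0 eq_sym//.
  rewrite (lt_le_trans (st_ne r1))// !Sk -/r le_eqVlt; apply/orP; left; apply/eqP.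
  have rm : 1 - r ^+ m != 0.
    by apply: contraTneq Sm0 => e; rewrite Sk e mul0r ltxx.
  by field; rewrite subr_eq0 eq_sym r1 rm.
rewrite -/(S m.+1) (_ : _ + _ = (mu2 / mu1) * (S m.+1 - lam / mu2 * S m)); last first.
  by rewrite SS /r; field; rewrite !gt_eqF.
by rewrite mulr_gt0 ?divr_gt0// subr_gt0.
Qed.

(** Taking the minimum with all the entries before applying the intermediate value
    theorem guarantees that the entries are nonnegative at the root obtained. *)
Fixpoint phase_min m (k : nat) z : R :=
  if k is k'.+1 then Num.min (phase_min m k' z) (X z k) else E z m.

Lemma phase_min_continuous m k : continuous (phase_min m k).
Proof.
elim: k => [|k IHk]; first by have [] := phase_rec_continuous m.
have [cX _] := phase_rec_continuous k.+1.
move=> z; exact: (continuous_min (IHk z) (cX z)).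
Qed.

Lemma phase_min_ge m k z : 0 <= phase_min m k z ->
  0 <= E z m /\ forall j, (0 < j <= k)%N -> 0 <= X z j.
Proof.
elim: k => [|k IHk]; first by move=> h; split => // j; lia.
rewrite le_min => /andP[/IHk [Em Xk] Xk1]; split => // j /andP[j0].
by rewrite leq_eqVlt => /orP[/eqP -> //|jk]; apply: Xk; rewrite j0.
Qed.

Lemma phase_min_le m k z j : (0 < j <= k)%N -> phase_min m k z <= X z j.
Proof.
elim: k => [|k IHk] jk; first by lia.
rewrite [leLHS]/(Num.min _ _) ge_min.
have [->|jk'] := eqVneq j k.+1; first by rewrite lexx orbT.
by rewrite IHk//; lia.
Qed.

Lemma phase_min_eq0 m k z : phase_min m k z = 0 ->
  E z m = 0 \/ exists2 j, (0 < j <= k)%N & X z j = 0.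
Proof.
elim: k => [|k IHk]; first by left.
rewrite [LHS]/(Num.min (phase_min m k z) (X z k.+1)); case: leP => _ e.
  by right; exists k.+1 => //; rewrite leqnn.
case: (IHk e) => [|[j jk Xj]]; [by left|right; exists j => //; lia].
Qed.

(** The minimum of [E_m, X_1, ..., X_(m+1)] is positive at [z = 1] by stability,
    and nonpositive at a small [z] because [X_2] is.  At a zero of it in between no
    [X_j] with [j <= m] vanishes, as [X_(j+1)] would then be negative, nor does
    [X_(m+1) >= z X_m]; hence [E_m] vanishes. *)
Lemma finite_capacity_root m : stable lam mu1 mu2 m.+1 ->
  exists h, [/\ 0 < h < 1, forall j, (j <= m.+1)%N -> 0 < X h j & E h m.+1 = 0].
Proof.
move=> st; pose tot := lam + mu1 + mu2.
have tot0 : 0 < tot by rewrite !addr_gt0.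
(* small enough for [X_2 <= 0], as [lam X_1 <= z tot] *)
pose z0 := lam * mu1 / tot ^+ 2.
have z00 : 0 < z0 by rewrite divr_gt0 ?mulr_gt0 ?exprn_gt0.
have z01 : z0 < 1.
  rewrite ltr_pdivrMr ?exprn_gt0// mul1r /tot expr2.
  have := mulr_gt0 lam_gt0 mu1_gt0; have := mulr_gt0 mu1_gt0 mu2_gt0.
  have := mulr_gt0 lam_gt0 mu2_gt0; have := mulr_gt0 mu1_gt0 mu1_gt0.
  have := mulr_gt0 lam_gt0 lam_gt0; have := mulr_gt0 mu2_gt0 mu2_gt0.
  by lra.
pose psi := phase_min m.+1 m.+2.
have psi1 : 0 < psi 1.
  rewrite /psi; elim: (m.+2) => [|k IHk].
    exact: stable_slope_gt0.
  by rewrite [phase_min _ _ _]/(Num.min _ _) lt_min IHk phase_rec_at1/=.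
have psi0 : psi z0 <= 0.
  have : X z0 2 <= 0.
    rewrite -(@pmulr_rle0 _ lam)// phase_recSS pmulr_rle0// subr_le0 -[X z0 0]/1 mulr1.
    rewrite -(@ler_pM2l _ lam)// mulrCA phase_rec1.
    have m2z : 0 <= mu2 * (1 - z0) by rewrite mulr_ge0 ?subr_ge0 ?ltW.
    have m2z' : mu2 * (1 - z0) <= mu2 by rewrite ler_piMr ?gerBl ?ltW.
    apply: (@le_trans _ _ (tot * (z0 * tot))).
      apply: ler_pM.
      - by rewrite ltW// ltr_wpDr// addr_gt0.
      - by rewrite mulr_ge0 ?ltW// ltr_wpDr.
      - by rewrite lerD2l.
      - by rewrite ler_pM2l// /tot -addrA lerD2l ler_wpDl// ltW.
    rewrite /z0 le_eqVlt; apply/orP; left; apply/eqP; field.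
    by rewrite gt_eqF.
  by move=> X2; apply: le_trans X2; exact: phase_min_le.
have [h] : exists2 h, h \in `[z0, 1] & psi h = 0.
  apply: IVT; first exact: ltW.
    by apply: continuous_subspaceT; exact: phase_min_continuous.
  rewrite ge_min psi0/= le_max; apply/orP; right; exact: ltW.
rewrite in_itv /= => /andP[z0h h1] psih.
have h0 : 0 < h by exact: lt_le_trans z0h.
have h1' : h < 1.
  by rewrite lt_neqAle h1 andbT; apply: contraTneq psi1 => <-; rewrite psih ltxx.
have [Em Xh] : 0 <= E h m.+1 /\ forall j, (0 < j <= m.+2)%N -> 0 <= X h j.
  by apply: phase_min_ge; rewrite -/(psi h) psih.
have Xpos j : (j <= m.+1)%N -> 0 < X h j.
  elim: j => [|j IHj] jm; first exact: ltr01.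
  rewrite lt_neqAle Xh ?andbT; last exact: leqW.
  apply/eqP => Xj; have : 0 <= X h j.+2 by exact: Xh.
  rewrite -(@pmulr_rge0 _ lam)// phase_recSS -Xj mulr0 sub0r mulrN oppr_ge0.
  by rewrite leNgt !mulr_gt0// IHj// ltnW.
have Xm2 : 0 < X h m.+2.
  by rewrite phase_recS ltr_pwDl ?mulr_gt0 ?Xpos// mulr_ge0// subr_ge0 ltW.
exists h; split => //; first by rewrite h0.
have [//|[j /andP[j0 jm]]] := phase_min_eq0 psih.
move/eqP; rewrite gt_eqF//; move: jm; rewrite leq_eqVlt => /orP[/eqP ->//|jm].
by rewrite Xpos.
Qed.
End PhaseRecursion.

(** * The matrix H *)

Section NonnegMatrices.
Context {R : realType}.

Definition mx_le {m n} (A B : 'M[R]_(m, n)) : Prop := forall i j, A i j <= B i j.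

Lemma mx_le_trans m n (B A C : 'M[R]_(m, n)) : mx_le A B -> mx_le B C -> mx_le A C.
Proof. by move=> AB BC i j; exact: le_trans (AB i j) (BC i j). Qed.

Lemma mulmx_ge0 m n p (A : 'M[R]_(m, n)) (B : 'M[R]_(n, p)) :
  mx_le 0 A -> mx_le 0 B -> mx_le 0 (A *m B).
Proof.
move=> A0 B0 i j; rewrite !mxE sumr_ge0// => k _.
by have := A0 i k; have := B0 k j; rewrite !mxE => *; exact: mulr_ge0.
Qed.

Lemma mulmx_le m n p (A B : 'M[R]_(m, n)) (C D : 'M[R]_(n, p)) :
  mx_le 0 A -> mx_le 0 C -> mx_le A B -> mx_le C D -> mx_le (A *m C) (B *m D).
Proof.
move=> A0 C0 AB CD i j; rewrite !mxE ler_sum// => k _.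
by have := A0 i k; have := C0 k j; rewrite !mxE => *; exact: ler_pM.
Qed.

Lemma cvg_mulmx m n p (A : nat -> 'M[R]_(m, n)) (B : nat -> 'M[R]_(n, p))
  (A' : 'M[R]_(m, n)) (B' : 'M[R]_(n, p)) :
  (forall i j, A k i j @[k --> \oo] --> A' i j) ->
  (forall i j, B k i j @[k --> \oo] --> B' i j) ->
  forall i j, (A k *m B k) i j @[k --> \oo] --> (A' *m B') i j.
Proof.
move=> cA cB i j; rewrite mxE; under eq_cvg do rewrite mxE.
by apply: cvg_big => [|l _]; [exact: add_continuous|exact: cvgM].
Qed.

End NonnegMatrices.

Section MinimalSolution.
Context {R : realType}.
Variables (lam mu1 mu2 : R) (m : nat).
Hypotheses (lam_gt0 : 0 < lam) (mu1_gt0 : 0 < mu1) (mu2_gt0 : 0 < mu2).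
Hypothesis m_gt0 : (0 < m)%N.

Local Notation arr := (arrival_rate lam (Some m)).
Local Notation srv := (service_rate mu1).
Local Notation Q0 := (Q0 mu1 m).
Local Notation Q1 := (Q1 lam mu1 mu2 m).
Local Notation Q2 := (Q2 mu2 m).

Definition diag_rate (j : nat) := arr j + srv j + mu2.

Lemma diag_rate_gt0 j : 0 < diag_rate j.
Proof.
by rewrite ltr_wpDl// addr_ge0// (arrival_rate_ge0,service_rate_ge0).
Qed.

Definition Qup : 'M[R]_m.+1 := \matrix_(i, j) if j == i.+1 :> nat then lam else 0.

Lemma Q1E : Q1 = Qup - diag_mx (\row_(i < m.+1) diag_rate i).
Proof.
apply/matrixP => i j; rewrite !mxE /diag_rate /arrival_rate /service_rate /=.
have [ji|ji] := eqVneq (j : nat) i.+1.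
  have -> : (i == j) = false by apply/eqP => e; move: ji; rewrite e; lia.
  by rewrite mulr0n subr0.
have [->|ij] := eqVneq i j; last by rewrite mulr0n subr0.
have := ltn_ord j; rewrite ltnS => jm.
rewrite mulr1n sub0r; have [j0|j0] := posnP j.
  by rewrite j0 m_gt0 addr0.
have [jem|jem] := eqVneq (j : nat) m; first by rewrite jem ltnn add0r.
by rewrite ltn_neqAle jem jm.
Qed.

Lemma nonneg_solutionE G : nonneg_solution lam mu1 mu2 G <->
  mx_le 0 G /\ forall i j : 'I_m.+1,
    diag_rate i * G i j = (Q0 + Qup *m G + mu2 *: (G *m G)) i j.
Proof.
have eq : Q0 + Q1 *m G + Q2 *m (G *m G) =
   Q0 + Qup *m G + mu2 *: (G *m G) - diag_mx (\row_(i < m.+1) diag_rate i) *m G.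
  rewrite Q1E mulmxBl /Defs.Q2 mul_scalar_mx.
  by rewrite addrA -!addrA [- _ + _]addrC.
split=> -[G0 e].
  split => [i j|i j]; first by rewrite mxE.
  move/eqP: e; rewrite eq subr_eq0 => /eqP ->.
  by rewrite mul_diag_mx !mxE.
split=> [i j|]; first by have := G0 i j; rewrite mxE.
rewrite eq; apply/eqP; rewrite subr_eq0; apply/eqP/matrixP => i j.
by rewrite -e mul_diag_mx !mxE.
Qed.

(** The fixed-point form of the equation of [H]: the first transition either goes
    one level up, or is followed by one upward passage if the level is unchanged
    and by two if it has decreased. *)
Definition passage_step (G : 'M[R]_m.+1) : 'M[R]_m.+1 :=
  \matrix_(i, j) ((Q0 + Qup *m G + mu2 *: (G *m G)) i j / diag_rate i).

Lemma Q0_ge0 : mx_le 0 Q0.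
Proof. by move=> i j; rewrite !mxE; case: ifP => // _; exact: ltW. Qed.

Lemma Qup_ge0 : mx_le 0 Qup.
Proof. by move=> i j; rewrite !mxE; case: ifP => // _; exact: ltW. Qed.

Lemma passage_step_le A B : mx_le 0 A -> mx_le A B ->
  mx_le (passage_step A) (passage_step B).
Proof.
move=> A0 AB i j.
have h1 := mulmx_le Qup_ge0 A0 (fun i j => lexx _) AB i j.
have h2 := mulmx_le A0 A0 AB AB i j.
rewrite [leLHS]mxE [leRHS]mxE ler_pM2r ?invr_gt0 ?diag_rate_gt0//.
rewrite [leLHS]mxE [leRHS]mxE lerD//.
  by rewrite [leLHS]mxE [leRHS]mxE lerD2l.
by rewrite [leLHS]mxE [leRHS]mxE ler_pM2l.
Qed.

Lemma passage_step_ge0 A : mx_le 0 A -> mx_le 0 (passage_step A).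
Proof.
move=> A0 i j.
have h1 := mulmx_ge0 Qup_ge0 A0 i j; have h2 := mulmx_ge0 A0 A0 i j.
have h3 := Q0_ge0 i j; move: h1 h2 h3.
rewrite !mxE => h1 h2 h3.
by rewrite divr_ge0 ?(ltW (diag_rate_gt0 _))// !addr_ge0// mulr_ge0// ltW.
Qed.

Definition passage_iter n : 'M[R]_m.+1 := iter n passage_step 0.

Lemma passage_iter_ge0 n : mx_le 0 (passage_iter n).
Proof.
elim: n => [|n IHn]; first by move=> i j; exact: lexx.
exact: passage_step_ge0.
Qed.

Lemma passage_iter_nd n : mx_le (passage_iter n) (passage_iter n.+1).
Proof.
elim: n => [|n IHn]; first exact: passage_iter_ge0.
by apply: passage_step_le => //; exact: passage_iter_ge0.
Qed.

Lemma passage_iter_le_solution n G : nonneg_solution lam mu1 mu2 G ->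
  mx_le (passage_iter n) G.
Proof.
move=> /nonneg_solutionE[G0 e]; elim: n => [//|n IHn].
apply: mx_le_trans (passage_step_le (passage_iter_ge0 n) IHn) _ => i j.
rewrite [leLHS]mxE -e mulrC mulKf// gt_eqF//; exact: diag_rate_gt0.
Qed.

Definition phase_col (y : nat -> R) : 'cV[R]_m.+1 := \col_i y i.

Lemma Q0_phase_col y (i : 'I_m.+1) : (Q0 *m phase_col y) i 0 = srv i * y i.-1.
Proof.
rewrite mxE /service_rate; case: posnP => [i0|i0].
  by rewrite mul0r big1// => j _; rewrite !mxE i0 mul0r.
have im : (i.-1 < m.+1)%N by rewrite (leq_ltn_trans (leq_pred _)).
rewrite (bigD1 (Ordinal im))//= big1 ?addr0 => [|j ji].
  by rewrite !mxE/= prednK// eqxx.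
rewrite !mxE ifF ?mul0r//; apply: contraNF ji => /eqP e.
by apply/eqP/val_inj; rewrite /= e.
Qed.

Lemma Qup_phase_col y (i : 'I_m.+1) : (Qup *m phase_col y) i 0 = arr i * y i.+1.
Proof.
rewrite mxE /arrival_rate /=; case: ltnP => im.
  have im' : (i.+1 < m.+1)%N by [].
  rewrite (bigD1 (Ordinal im'))//= big1 ?addr0 => [|j ji].
    by rewrite !mxE/= eqxx.
  rewrite !mxE ifF ?mul0r//; apply: contraNF ji => /eqP e.
  by apply/eqP/val_inj; rewrite /= e.
rewrite mul0r big1// => j _; rewrite !mxE ifF ?mul0r//; apply/eqP => e.
by have := ltn_ord j; rewrite e; lia.
Qed.

Lemma phase_opP z y i : z != 0 -> phase_op lam mu1 mu2 (Some m) z y i = 0 ->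
  z * diag_rate i * y i =
  srv i * y i.-1 + z * (arr i * y i.+1) + z ^+ 2 * (mu2 * y i).
Proof.
move=> z0 e; rewrite -[RHS]subr0 -(mulr0 z) -e /phase_op /diag_rate.
by field.
Qed.

(** Optional stopping, at the first passage to the next level, of the martingale
    [y_j / z^k], which gains a factor [1 / z] per level. *)
Lemma passage_iter_phase_col z y n : 0 < z ->
  (forall i, (i <= m)%N -> 0 <= y i) ->
  (forall i, (i <= m)%N -> phase_op lam mu1 mu2 (Some m) z y i = 0) ->
  mx_le (passage_iter n *m phase_col y) (z *: phase_col y).
Proof.
move=> z0 y0 op0; elim: n => [|n IHn] i j; rewrite (ord1 j) {j}.
  by rewrite mul0mx !mxE mulr_ge0 ?(ltW z0)// y0// -ltnS.
have y0' : mx_le 0 (phase_col y) by move=> k j; rewrite !mxE y0// -ltnS.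
have A0 := passage_iter_ge0 n; set A := passage_iter n in IHn A0 *.
have Ay0 := mulmx_ge0 A0 y0'.
have h1 := mulmx_le Qup_ge0 Ay0 (fun i j => lexx _) IHn i 0.
have h2 : (A *m (A *m phase_col y)) i 0 <= z ^+ 2 * y i.
  apply: le_trans (mulmx_le A0 Ay0 (fun i j => lexx _) IHn i 0) _.
  rewrite -scalemxAr [leLHS]mxE expr2 -mulrA ler_pM2l//.
  by apply: le_trans (IHn i 0) _; rewrite !mxE.
have -> : passage_iter n.+1 = diag_mx (\row_(i < m.+1) (diag_rate i)^-1) *m
    (Q0 + Qup *m A + mu2 *: (A *m A)).
  by apply/matrixP => k l; rewrite mul_diag_mx !mxE mulrC.
rewrite -mulmxA !mulmxDl -scalemxAl -!mulmxA.
rewrite mul_diag_mx [leLHS]mxE [X in X * _ <= _]mxE mulrC.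
rewrite ler_pdivrMr ?diag_rate_gt0//.
have im : (i <= m)%N by rewrite -ltnS.
have -> : (z *: phase_col y) i 0 * diag_rate i = z * diag_rate i * y i.
  by rewrite [X in X * _ = _]mxE [X in _ * X * _ = _]mxE; ring.
rewrite (phase_opP (lt0r_neq0 z0) (op0 i im)).
rewrite [leLHS]mxE [X in X + _ <= _]mxE Q0_phase_col; apply: lerD; last first.
  by rewrite [leLHS]mxE mulrCA ler_pM2l.
by rewrite lerD2l (le_trans h1)// -scalemxAr [leLHS]mxE Qup_phase_col.
Qed.

Lemma phase_op_const1 cap i : phase_op lam mu1 mu2 cap 1 (fun=> 1) i = 0.
Proof. by rewrite /phase_op divr1 !subrr !mulr0 mul0r addr0 subr0. Qed.

Lemma entry_le_row (A : 'M[R]_m.+1) (y : nat -> R) (i j : 'I_m.+1) : mx_le 0 A ->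
  (forall k : nat, 0 <= y k) -> A i j * y j <= (A *m phase_col y) i 0.
Proof.
move=> A0 y0; rewrite [leRHS]mxE (bigD1 j)//= [phase_col _ _ _]mxE lerDl.
apply: sumr_ge0 => k _; have := A0 i k; rewrite !mxE => Aik.
by rewrite mulr_ge0.
Qed.

(** The constant vector is harmonic at [z = 1], so row sums are at most 1. *)
Lemma passage_iter_le1 n i j : passage_iter n i j <= 1.
Proof.
have op1 (k : nat) : (k <= m)%N -> phase_op lam mu1 mu2 (Some m) 1 (fun=> 1) k = 0.
  by move=> _; exact: phase_op_const1.
have := passage_iter_phase_col n ltr01 (fun _ _ => ler01) op1 i 0.
rewrite scale1r [leRHS]mxE; apply: le_trans.
by rewrite -[leLHS]mulr1; apply: (entry_le_row (y := fun=> 1)) => //; exact: passage_iter_ge0.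
Qed.

Definition passage_mx : 'M[R]_m.+1 :=
  \matrix_(i, j) limn (fun n => passage_iter n i j).

Local Notation H := passage_mx.

Lemma passage_mx_cvg i j : passage_iter n i j @[n --> \oo] --> H i j.
Proof.
rewrite mxE; apply: nondecreasing_is_cvgn.
  by apply/nondecreasing_seqP => n; exact: passage_iter_nd.
by exists 1 => _ [n _ <-]; exact: passage_iter_le1.
Qed.

Lemma passage_iter_le_mx n : mx_le (passage_iter n) H.
Proof.
move=> i j; rewrite [leRHS]mxE.
apply: (@nondecreasing_cvgn_le _ (fun n => passage_iter n i j)).
  by apply/nondecreasing_seqP => k; exact: passage_iter_nd.
by apply: cvgP; exact: @passage_mx_cvg.
Qed.

Lemma passage_mx_ge0 : mx_le 0 H.
Proof. exact: (passage_iter_le_mx 0). Qed.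

Lemma passage_mx_minimal : minimal_nonneg_solution lam mu1 mu2 H.
Proof.
split; last first.
  move=> G solG i j; apply: (cvgr_to_le (@passage_mx_cvg i j)).
  by apply: nearW => n; exact: passage_iter_le_solution.
apply/nonneg_solutionE; split=> [|i j]; first exact: passage_mx_ge0.
have cI (k l : 'I_m.+1) : Qup k l @[n --> \oo] --> Qup k l by exact: cvg_cst.
have cU : (Qup *m passage_iter n) i j @[n --> \oo] --> (Qup *m H) i j.
  by apply: (cvg_mulmx (A := fun=> Qup)) => // k l; exact: passage_mx_cvg.
have cHH : (passage_iter n *m passage_iter n) i j @[n --> \oo] --> (H *m H) i j.
  by apply: cvg_mulmx => k l; exact: passage_mx_cvg.
have entryE (A : 'M[R]_m.+1) : (Q0 + Qup *m A + mu2 *: (A *m A)) i j =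
    Q0 i j + (Qup *m A) i j + mu2 * (A *m A) i j.
  by rewrite [LHS]mxE [X in X + _]mxE [X in _ + X]mxE.
have lim_r : Q0 i j + (Qup *m passage_iter n) i j
      + mu2 * (passage_iter n *m passage_iter n) i j @[n --> \oo] -->
    Q0 i j + (Qup *m H) i j + mu2 * (H *m H) i j.
  by apply: cvgD; [apply: cvgD => //; exact: cvg_cst|exact: cvgMr].
have lim_l : diag_rate i * passage_iter n.+1 i j @[n --> \oo] --> diag_rate i * H i j.
  apply: cvgMr; have := @passage_mx_cvg i j; by rewrite -cvg_shiftS.
rewrite entryE; apply: (cvg_unique (@norm_hausdorff _ _) lim_l).
rewrite (_ : (fun n => _) = (fun n => Q0 i j + (Qup *m passage_iter n) i j
      + mu2 * (passage_iter n *m passage_iter n) i j))//; apply/funext => n.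
by rewrite -entryE [passage_iter _.+1 _ _]mxE mulrC divfK// gt_eqF// diag_rate_gt0.
Qed.

Lemma passage_mx_phase_col z y : 0 < z ->
  (forall i, (i <= m)%N -> 0 <= y i) ->
  (forall i, (i <= m)%N -> phase_op lam mu1 mu2 (Some m) z y i = 0) ->
  mx_le (H *m phase_col y) (z *: phase_col y).
Proof.
move=> z0 y0 op0 i j.
have cI (k : 'I_m.+1) (l : 'I_1) : phase_col y k l @[n --> \oo] --> phase_col y k l by exact: cvg_cst.
have c : (passage_iter n *m phase_col y) i j @[n --> \oo] --> (H *m phase_col y) i j.
  by apply: (cvg_mulmx (B := fun=> phase_col y)) => // k l; exact: passage_mx_cvg.
apply: (cvgr_to_le c); apply: nearW => n; exact: passage_iter_phase_col.
Qed.

(** The matrix polynomial factors as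
    [Q0 + z Q1 + z^2 Q2 = (Q1 + Q2 H + z Q2) (z - H)], so that the defect
    [z y - H y] of a root vector is killed by the first factor. *)
Lemma defectE z y (i : 'I_m.+1) : z != 0 ->
  (forall i, (i <= m)%N -> phase_op lam mu1 mu2 (Some m) z y i = 0) ->
  let d := z *: phase_col y - H *m phase_col y in
  diag_rate i * d i 0 =
    (Qup *m d) i 0 + mu2 * (H *m d) i 0 + z * mu2 * d i 0.
Proof.
move=> z0 op0 d.
have im : (i <= m)%N by rewrite -ltnS.
have [/nonneg_solutionE[_ solH] _] := passage_mx_minimal.
have HE : diag_rate i * (H *m phase_col y) i 0 =
    srv i * y i.-1 + (Qup *m (H *m phase_col y)) i 0
      + mu2 * (H *m (H *m phase_col y)) i 0.
  transitivity (((Q0 + Qup *m H + mu2 *: (H *m H)) *m phase_col y) i 0).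
    rewrite mxE mulr_sumr [RHS]mxE; apply: eq_bigr => k _.
    by rewrite mulrA solH.
  rewrite !mulmxDl -scalemxAl -!mulmxA [LHS]mxE [X in X + _]mxE Q0_phase_col.
  by rewrite [X in _ + X]mxE.
have e := phase_opP z0 (op0 i im).
have dE : d i 0 = z * y i - (H *m phase_col y) i 0 by rewrite /d !mxE.
have UdE : (Qup *m d) i 0 = z * (arr i * y i.+1) - (Qup *m (H *m phase_col y)) i 0.
  rewrite /d mulmxBr -scalemxAr [LHS]mxE [X in X + _]mxE Qup_phase_col.
  by rewrite [X in _ + X]mxE.
have HdE : (H *m d) i 0 = z * (H *m phase_col y) i 0 - (H *m (H *m phase_col y)) i 0.
  by rewrite /d mulmxBr -scalemxAr [LHS]mxE [X in X + _]mxE [X in _ + X]mxE.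
rewrite dE UdE HdE; move: HE e.
move: ((H *m phase_col y) i 0) ((Qup *m (H *m phase_col y)) i 0)
  ((H *m (H *m phase_col y)) i 0) => a b c HE e.
have -> : diag_rate i * (z * y i - a) = z * diag_rate i * y i - diag_rate i * a by ring.
by rewrite HE e; ring.
Qed.

Section Eigenvector.
Variables (h : R) (x : nat -> R).
Hypotheses (h01 : 0 < h < 1) (x_gt0 : forall i, (i <= m)%N -> 0 < x i).
Hypothesis x_harmonic :
  forall i, (i <= m)%N -> phase_op lam mu1 mu2 (Some m) h x i = 0.

Let h_gt0 : 0 < h. Proof. by case/andP: h01. Qed.
Let x_ge0 i : (i <= m)%N -> 0 <= x i. Proof. by move=> im; exact/ltW/x_gt0. Qed.

(** The vector [1 - H 1] of the probabilities never to reach the next level, in the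
    form of the defect of the constant vector at the root 1. *)
Definition escape : 'cV[R]_m.+1 := 1 *: phase_col (fun=> 1) - H *m phase_col (fun=> 1).

Lemma escape_ge0 : mx_le 0 escape.
Proof.
move=> i j; rewrite [leLHS]mxE [leRHS]mxE [X in _ + X]mxE subr_ge0.
exact: (passage_mx_phase_col ltr01 (fun _ _ => ler01) (fun k _ => phase_op_const1 (Some m) k)).
Qed.

Lemma escapeE (i : 'I_m.+1) : diag_rate i * escape i 0 =
  (Qup *m escape) i 0 + mu2 * (H *m escape) i 0 + mu2 * escape i 0.
Proof.
have := @defectE 1 (fun=> 1) i (oner_neq0 _) (fun k _ => phase_op_const1 (Some m) k).
by rewrite /= [1 * mu2]mul1r.
Qed.

Lemma passage_mx_below (i j : 'I_m.+1) : i = j.+1 :> nat -> 0 < H i j.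
Proof.
move=> ij; apply: lt_le_trans (passage_iter_le_mx 1 i j).
rewrite [ltRHS]mxE divr_gt0 ?diag_rate_gt0//.
by rewrite mulmx0 mulmx0 scaler0 !addr0 mxE ij eqxx.
Qed.

Lemma escape_neighbours (i : 'I_m.+1) : escape i 0 = 0 ->
  (Qup *m escape) i 0 = 0 /\ (H *m escape) i 0 = 0.
Proof.
move=> wi; have := escapeE i; rewrite wi !mulr0 addr0.
have := mulmx_ge0 Qup_ge0 escape_ge0 i 0; rewrite [leLHS]mxE => a.
have := mulmx_ge0 passage_mx_ge0 escape_ge0 i 0; rewrite [leLHS]mxE => b.
move/esym/eqP; rewrite paddr_eq0 ?mulr_ge0 ?(ltW mu2_gt0)// => /andP[/eqP -> ].
by rewrite mulf_eq0 (gt_eqF mu2_gt0) /= => /eqP ->.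
Qed.

Lemma mulmx_entry_eq0 (A : 'M[R]_m.+1) (v : 'cV[R]_m.+1) i j :
  mx_le 0 A -> mx_le 0 v -> (A *m v) i 0 = 0 -> 0 < A i j -> v j 0 = 0.
Proof.
move=> A0 v0; rewrite mxE => /eqP; rewrite psumr_eq0 => [|k _]; last first.
  by have := A0 i k; have := v0 k 0; rewrite !mxE => *; exact: mulr_ge0.
move=> /allP/(_ j (mem_index_enum _)) /= /eqP/eqP; rewrite mulf_eq0 => /orP[/eqP ->|/eqP//].
by rewrite ltxx.
Qed.

(** A vanishing escape probability would propagate to all phases, so that [H]
    would be stochastic; but [H x <= h x] with [h < 1]. *)
Lemma escape_gt0 (i : 'I_m.+1) : 0 < escape i 0.
Proof.
have w0 k : 0 <= escape k 0 by have := escape_ge0 k 0; rewrite [leLHS]mxE.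
rewrite lt_neqAle w0 andbT; apply/eqP => /esym wi.
have up n (j : 'I_m.+1) : j = (i + n)%N :> nat -> escape j 0 = 0.
  elim: n j => [|n IHn] j jn.
    by rewrite (_ : j = i)//; apply/val_inj; rewrite /= jn addn0.
  have jm : (i + n < m.+1)%N by have := ltn_ord j; rewrite jn; lia.
  have [/mulmx_entry_eq0 + _] := escape_neighbours (IHn (Ordinal jm) erefl).
  apply; [exact: Qup_ge0|exact: escape_ge0|].
  by rewrite mxE /= jn addnS eqxx.
have down n (j : 'I_m.+1) : (j + n)%N = m -> escape j 0 = 0.
  elim: n j => [|n IHn] j jn.
    by apply: (up (m - i)%N); have := ltn_ord i; lia.
  have jm : (j.+1 < m.+1)%N by lia.
  have [|_ /mulmx_entry_eq0] := escape_neighbours (IHn (Ordinal jm) _).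
    by rewrite /=; lia.
  apply; [exact: passage_mx_ge0|exact: escape_ge0|exact: passage_mx_below].
have all0 (j : 'I_m.+1) : escape j 0 = 0.
  by apply: (down (m - j)%N); have := ltn_ord j; lia.
have [k _ min_k] := @arg_minP _ _ _ (ord0 : 'I_m.+1) xpredT (fun k => x k) isT.
have km : (k <= m)%N by rewrite -ltnS.
have := passage_mx_phase_col h_gt0 x_ge0 x_harmonic k 0.
apply/negP; rewrite -ltNge [ltLHS]mxE [X in h * X]mxE.
have h1 : h * x k < x k by rewrite gtr_pMl ?x_gt0//; case/andP: h01.
apply: (lt_le_trans h1); have := all0 k.
rewrite /escape scale1r [LHS]mxE [X in X + _]mxE [X in _ + X]mxE => /eqP.
rewrite subr_eq0 => /eqP e; rewrite -[leLHS]mul1r e [X in X * _ <= _]mxE [leRHS]mxE mulr_suml ler_sum// => l _.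
rewrite [X in _ * X * _]mxE [X in _ <= _ * X]mxE mulr1; have := passage_mx_ge0 k l; rewrite [leLHS]mxE => Hkl.
by rewrite ler_wpM2l// min_k.
Qed.

(** Both [d = h x - H x] and [w = 1 - H 1] are nonnegative and satisfy
    [(- Q1 - Q2 H) d = h mu2 d] and [(- Q1 - Q2 H) w = mu2 w].  Comparing [d] with the
    least multiple of [w] above it at a point of contact gives [d <= h d] there,
    which forces [d = 0]. *)
Lemma passage_mx_eigenvector : H *m phase_col x = h *: phase_col x.
Proof.
pose d := h *: phase_col x - H *m phase_col x.
have d0 (i : 'I_m.+1) : 0 <= d i 0.
  rewrite /d [leRHS]mxE [X in _ + X]mxE subr_ge0.
  exact: (passage_mx_phase_col h_gt0 x_ge0 x_harmonic).
suff dle (i : 'I_m.+1) : d i 0 <= 0.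
  apply/esym/eqP; rewrite -subr_eq0 -/d; apply/eqP/matrixP => i j.
  by rewrite (ord1 j) [RHS]mxE; apply/le_anti; rewrite d0 dle.
have [k _ max_k] := @arg_maxP _ _ _ (ord0 : 'I_m.+1) xpredT
  (fun k => d k 0 / escape k 0) isT.
pose r := d k 0 / escape k 0.
have dr (j : 'I_m.+1) : d j 0 <= r * escape j 0.
  by rewrite -ler_pdivrMr ?escape_gt0//; exact: max_k.
suff dk : d k 0 <= 0.
  rewrite (le_trans (dr i))// mulr_le0_ge0 ?(ltW (escape_gt0 _))//.
  by rewrite /r mulr_le0_ge0// invr_ge0 ltW// escape_gt0.
rewrite leNgt; apply/negP => dk0.
have rk : d k 0 = r * escape k 0 by rewrite divfK// gt_eqF// escape_gt0.
have e := @defectE h x k (lt0r_neq0 h_gt0) x_harmonic.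
have eU : (Qup *m d) k 0 <= r * (Qup *m escape) k 0.
  rewrite [leLHS]mxE [X in _ <= _ * X]mxE mulr_sumr ler_sum// => l _; rewrite mulrCA.
  by have := Qup_ge0 k l; rewrite [leLHS]mxE => A0; rewrite ler_wpM2l.
have eH : (H *m d) k 0 <= r * (H *m escape) k 0.
  rewrite [leLHS]mxE [X in _ <= _ * X]mxE mulr_sumr ler_sum// => l _; rewrite mulrCA.
  by have := passage_mx_ge0 k l; rewrite [leLHS]mxE => A0; rewrite ler_wpM2l.
have w := escapeE k; move: e; rewrite -/d /= => e.
have : h * mu2 * d k 0 < mu2 * d k 0.
  rewrite ltr_pM2r// gtr_pMl//; by case/andP: h01.
have eH' : mu2 * (H *m d) k 0 <= mu2 * (r * (H *m escape) k 0) by rewrite ler_pM2l.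
have rw : r * (diag_rate k * escape k 0) = diag_rate k * d k 0 by rewrite rk; ring.
rewrite w in rw.
apply/negP; rewrite -leNgt.
have : mu2 * d k 0 = mu2 * (r * escape k 0) by rewrite {1}rk.
move: rw; rewrite !mulrDr e.
by lra.
Qed.

(** The positive right eigenvector [x] bounds all eigenvalues: if [v H = z v], then
    summing [|z| |v_j| <= sum_i |v_i| H_ij] against the weights [x_j] gives [|z| <= h]. *)
Lemma passage_mx_maximal_eigenvalue : maximal_eigenvalue H h.
Proof.
have Hx := passage_mx_eigenvector; split; first exact: ltW.
- have : \det (H - h%:M) == 0.
    apply/eqP; apply: contraTeq (x_gt0 (leq0n m)) => /negP detN.
    have U : H - h%:M \in unitmx by rewrite unitmxE unitfE; apply/negP.
    have : phase_col x = 0.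
      rewrite -[LHS](mulKmx U) mulmxBl Hx mul_scalar_mx subrr mulmx0//.
    by move/matrixP/(_ ord0 0); rewrite !mxE => ->; rewrite ltxx.
  move=> /eqP det0; rewrite /eigenvalue -mxrank_eq0 mxrank_ker subn_eq0 -ltnNge.
  rewrite ltn_neqAle rank_leq_row andbT; apply/negP => full.
  have : H - h%:M \in unitmx by rewrite -row_free_unit.
  by rewrite unitmxE det0 unitr0.
- move=> z /eigenvalueP[v vH v0].
  pose xC (j : 'I_m.+1) := real_complex R (x j).
  have xC0 j : 0 < xC j.
    by rewrite ltcR x_gt0// -ltnS.
  pose S := \sum_j `|v 0 j| * xC j.
  have S0 : 0 < S.
    have [j vj] : exists j, v 0 j != 0.
      apply/existsP; apply: contraNT v0; rewrite negb_exists => /forallP vv.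
      by apply/eqP/rowP => j; rewrite mxE; apply/eqP; rewrite -[_ == _]negbK.
    rewrite /S (bigD1 j)//= ltr_pwDl ?mulr_gt0 ?normr_gt0//.
    by apply: sumr_ge0 => l _; rewrite mulr_ge0// ltW.
  rewrite -(ler_pM2r S0) {1}/S mulr_sumr.
  have -> : real_complex R h * S =
      \sum_j \sum_i `|v 0 i| * real_complex R (H i j) * xC j.
    rewrite exchange_big /= /S mulr_sumr; apply: eq_bigr => i _.
    under eq_bigr do rewrite -mulrA.
    rewrite -mulr_sumr mulrCA; congr (_ * _).
    have /matrixP/(_ i 0) := Hx; rewrite [LHS]mxE [RHS]mxE [X in _ = _ * X -> _]mxE => e.
    rewrite /xC -rmorphM -e rmorph_sum; apply: eq_bigr => l _.
    by rewrite [X in _ * X]mxE rmorphM.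
  apply: ler_sum => j _; rewrite mulrA -mulr_suml ler_pM2r// -normrM.
  have /rowP/(_ j) := vH; rewrite [X in _ = X -> _]mxE => <-.
  rewrite mxE (le_trans (ler_norm_sum _ _ _))// ler_sum// => i _.
  rewrite normrM [X in _ * `|X| <= _]mxE ler_wpM2l// ger0_norm// lecR.
  by have := passage_mx_ge0 i j; rewrite mxE.
Qed.

End Eigenvector.

End MinimalSolution.

(** * Infinite capacity *)

Section InfiniteCapacity.
Context {R : realType}.
Variables (lam mu1 mu2 : R).
Hypotheses (lam_gt0 : 0 < lam) (mu1_gt0 : 0 < mu1) (mu2_gt0 : 0 < mu2).

Local Notation tau := (tau lam mu1 mu2).
Local Notation X z j := (phase_rec lam mu1 mu2 z j).1.
Local Notation c z := (lam + mu1 + mu2 * (1 - z)).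

(** With [z = u^2] the function [u tau(z)] becomes a cubic, whose convexity on the
    half-line is a polynomial identity. *)
Definition tau_cubic u :=
  mu2 * u ^+ 3 - (lam + mu1 + mu2) * u + 2 * Num.sqrt (lam * mu1).

Lemma tau_sqr u : 0 < u -> tau (u ^+ 2) * u = tau_cubic u.
Proof.
move=> u0; rewrite /tau /tau_cubic sqrtrM ?mulr_ge0 ?ltW// sqrtrV ?sqr_ge0//.
by rewrite sqrtr_sqr gtr0_norm//; field; rewrite gt_eqF.
Qed.

Section Stable.
Hypothesis lam_mu1 : lam < mu1.

Lemma tau_cubic1_lt0 : tau_cubic 1 < 0.
Proof.
rewrite /tau_cubic sqrtrM ?ltW//.
have l2 : lam = Num.sqrt lam ^+ 2 by rewrite sqr_sqrtr// ltW.
have m2 : mu1 = Num.sqrt mu1 ^+ 2 by rewrite sqr_sqrtr// ltW.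
have : Num.sqrt lam < Num.sqrt mu1 by rewrite ltr_sqrt.
move: (Num.sqrt lam) (Num.sqrt mu1) l2 m2 => a b -> -> ab.
rewrite -subr_gt0 (_ : _ - _ = (b - a) ^+ 2); last by ring.
by rewrite exprn_gt0// subr_gt0.
Qed.

(** The cubic is convex on the half-line and negative at 1, so that once it is
    nonpositive it stays negative up to 1. *)
Lemma tau_lt0 y z : 0 < y -> y < z -> z < 1 -> tau y <= 0 -> tau z < 0.
Proof.
move=> y0 yz z1; have z0 := lt_trans y0 yz.
pose u := Num.sqrt y; pose v := Num.sqrt z.
have u0 : 0 < u by rewrite sqrtr_gt0.
have uv : u < v by rewrite ltr_sqrt.
have v0 := lt_trans u0 uv.
have v1 : v < 1 by rewrite -sqrtr1 ltr_sqrt.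
have -> : y = u ^+ 2 by rewrite sqr_sqrtr// ltW.
have -> : z = v ^+ 2 by rewrite sqr_sqrtr// ltW.
rewrite -(pmulr_lle0 _ u0) -(pmulr_llt0 _ v0) !tau_sqr// => pu.
have u1 : 0 < 1 - u by rewrite subr_gt0 (lt_trans uv).
rewrite -(pmulr_rlt0 _ u1).
rewrite (_ : _ * _ = (1 - v) * tau_cubic u + (v - u) * tau_cubic 1
   - mu2 * (v - u) * (1 - v) * (1 - u) * (u + v + 1)); last by rewrite /tau_cubic; ring.
have v1' : 0 < 1 - v by rewrite subr_gt0.
have vu : 0 < v - u by rewrite subr_gt0.
have h1 : (1 - v) * tau_cubic u <= 0 by rewrite pmulr_rle0.
have h2 : (v - u) * tau_cubic 1 < 0 by rewrite pmulr_rlt0// tau_cubic1_lt0.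
have h3 : 0 < mu2 * (v - u) * (1 - v) * (1 - u) * (u + v + 1).
  by rewrite !mulr_gt0// !addr_gt0.
by lra.
Qed.

Lemma tau_root : exists eta, 0 < eta < 1 /\ tau eta = 0.
Proof.
have p0 : 0 < tau_cubic 0.
  by rewrite /tau_cubic expr0n !mulr0 subrr add0r mulr_gt0// sqrtr_gt0 mulr_gt0.
have p1 := tau_cubic1_lt0.
have [u] : exists2 u, u \in `[0, 1] & tau_cubic u = 0.
  apply: IVT; first exact: ler01.
    apply: continuous_subspaceT => u.
    apply: cvgD; last exact: cvg_cst.
    apply: cvgB; apply: cvgMr; last exact: cvg_id.
    exact: exprn_continuous.
  by rewrite ge_min (ltW p1) orbT le_max (ltW p0).
rewrite in_itv /= => /andP[u0 u1] pu.
have u0' : 0 < u.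
  by rewrite lt_neqAle u0 andbT; apply/eqP => e; move: pu p0; rewrite -e => ->; rewrite ltxx.
have u1' : u < 1.
  by rewrite lt_neqAle u1 andbT; apply: contraTneq p1 => <-; rewrite pu ltxx.
exists (u ^+ 2); rewrite exprn_gt0//= exprn_ilt1 ?ltW//; split => //.
by apply/eqP; have := tau_sqr u0'; rewrite pu => /eqP; rewrite mulf_eq0 (gt_eqF u0') orbF.
Qed.

Lemma tau_root_unique y z : 0 < y < 1 -> 0 < z < 1 -> tau y = 0 -> tau z = 0 -> y = z.
Proof.
move=> /andP[y0 y1] /andP[z0 z1] ty tz; apply/eqP; rewrite eq_le !leNgt.
apply/andP; split; apply/negP => lt.
  by have := tau_lt0 z0 lt y1; rewrite tz ty => /(_ (lexx _)); rewrite ltxx.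
by have := tau_lt0 y0 lt z1; rewrite tz ty => /(_ (lexx _)); rewrite ltxx.
Qed.

Lemma tau_root_le eta : mu1 <= mu2 -> 0 < eta < 1 -> tau eta = 0 -> eta <= lam / mu1.
Proof.
move=> mu12 /andP[eta0 eta1] te; rewrite leNgt; apply/negP => lt.
have r0 : 0 < lam / mu1 by rewrite divr_gt0.
suff : tau (lam / mu1) <= 0 by move=> /(tau_lt0 r0 lt eta1); rewrite te ltxx.
rewrite /tau (_ : lam * mu1 / _ = mu1 ^+ 2); last by field; rewrite !gt_eqF.
rewrite sqrtr_sqr gtr0_norm// (_ : _ + _ = (mu1 - lam) * (1 - mu2 / mu1)); last first.
  by field; rewrite gt_eqF.
by rewrite pmulr_rle0 ?subr_gt0// subr_le0 ler_pdivlMr// mul1r.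
Qed.

End Stable.

(** At a zero of [tau] the characteristic equation of [phase_op] has the double
    root [s]; the coefficient [1 - eta s] is imposed by the equation at phase 0. *)
Definition root_phase_vec eta (j : nat) : R :=
  let s := Num.sqrt (mu1 / (lam * eta)) in s ^+ j * (1 + (1 - eta * s) * j%:R).

(** The condition [eta <= lam / mu1] says [eta s <= 1]. *)
Lemma root_phase_vec_gt0 eta j : 0 < eta -> eta <= lam / mu1 -> 0 < root_phase_vec eta j.
Proof.
move=> eta0 le; have a0 : 0 < mu1 / (lam * eta) by rewrite divr_gt0// mulr_gt0.
rewrite /root_phase_vec mulr_gt0 ?exprn_gt0 ?sqrtr_gt0// ltr_wpDr// mulr_ge0// subr_ge0.
rewrite -(@ler_pXn2r _ 2)// ?nnegrE ?mulr_ge0 ?sqrtr_ge0 ?(ltW eta0)//.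
rewrite exprMn sqr_sqrtr ?(ltW a0)// expr1n.
rewrite (_ : _ * _ = eta * (mu1 / lam)); last by field; rewrite !gt_eqF.
by rewrite -[leRHS](@divff _ (lam / mu1)) ?gt_eqF ?divr_gt0// invf_div ler_pM2r ?divr_gt0.
Qed.

Lemma root_phase_vec_harmonic eta j : 0 < eta -> tau eta = 0 ->
  phase_op lam mu1 mu2 None eta (root_phase_vec eta) j = 0.
Proof.
move=> eta0 te; rewrite /phase_op /arrival_rate /service_rate /root_phase_vec /=.
have a0 : 0 <= mu1 / (lam * eta) by rewrite ltW// divr_gt0// mulr_gt0.
have s2 := sqr_sqrtr a0; move: te; rewrite /tau.
have -> : lam * mu1 / eta = lam ^+ 2 * (mu1 / (lam * eta)) by field; rewrite !gt_eqF.
rewrite sqrtrM ?sqr_ge0// sqrtr_sqr gtr0_norm//.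
set s := Num.sqrt _ in s2 *.
have m1 : mu1 = lam * eta * s ^+ 2 by rewrite s2; field; rewrite !gt_eqF.
move=> te; have -> : mu2 * (1 - eta) = 2 * lam * s - lam - mu1 by lra.
case: j => [|j]; first by rewrite !expr0 expr1 {2}m1 /=; ring.
rewrite ltn0Sn succnK {1 2}m1 !exprS -!natr1; move: (s ^+ j) => sj.
by field; rewrite gt_eqF.
Qed.

(** The corresponding harmonic function [(mu2 / lam)^(k + j)] depends on the total
    number of customers only. *)
Lemma product_phase_vec_harmonic j :
  phase_op lam mu1 mu2 None (lam / mu2) (fun j => (mu2 / lam) ^+ j) j = 0.
Proof.
rewrite /phase_op /arrival_rate /service_rate /=.
case: j => [|j]; first by rewrite expr0 expr1 /=; field; rewrite !gt_eqF.
by rewrite ltn0Sn succnK !exprS; field; rewrite !gt_eqF// mulf_neq0 ?gt_eqF.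
Qed.

(** ** Sign changes of the phase vectors below the critical value *)

Lemma phase_vecSS z j : z != 0 -> let x := phase_vec lam mu1 mu2 z in
  lam * x j.+2 = c z * x j.+1 - mu1 / z * x j.
Proof.
move=> z0 /=; rewrite /phase_vec mulrA phase_recSS// !exprS; field.
by rewrite z0 expf_neq0.
Qed.

(** The ratios of successive entries start from [1 / z] and, as long as the entries
    stay positive, a ratio [s] is followed by one that is smaller by the value of
    the characteristic polynomial at [s] divided by [lam s], which is bounded away
    from 0.  The first sign change is the phase at which the box of [upcross_ge] is cut. *)
Lemma phase_vec_sign_change z p : 0 < z < 1 -> 0 < p ->
  (forall s, 0 < s <= z^-1 -> p <= lam * s ^+ 2 - c z * s + mu1 / z) ->
  exists n, (forall j, (j <= n)%N -> 0 < phase_vec lam mu1 mu2 z j)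
    /\ phase_vec lam mu1 mu2 z n.+1 <= 0.
Proof.
move=> /andP[z0 z1] p0 ps; set x := phase_vec lam mu1 mu2 z.
have x00 : x 0%N = 1 by rewrite /x /phase_vec /= divr1.
pose k := p * z / lam; have k0 : 0 < k by rewrite divr_gt0// mulr_gt0.
have step s t : 0 < s <= z^-1 -> lam * t * s = c z * s - mu1 / z -> t <= s - k.
  move=> /andP[s0 sz] ts; have := ps s; rewrite s0 sz => /(_ isT) h.
  rewrite -(@ler_pM2l _ (lam * s)) ?mulr_gt0// mulrAC ts.
  have : lam * s * k <= p.
    have -> : lam * s * k = p * (s * z) by rewrite /k; field; rewrite gt_eqF.
    by rewrite ler_piMr ?(ltW p0)// -ler_pdivlMr// mul1r.
  by rewrite mulrBr; lra.
have ex_neg : exists n, ~~ (0 < x n).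
  apply: contrapT => /forallNP all_pos.
  have x_gt0 n : 0 < x n by apply/negPn/negP; exact: all_pos.
  have ratio n : x n.+1 / x n <= z^-1 - k *+ n.+1.
    elim: n => [|n IHn].
      rewrite mulr1n; apply: step; first by rewrite invr_gt0 z0 lexx.
      have := phase_rec1 mu1 mu2 lam_gt0 z => e.
      rewrite x00 divr1 /x /phase_vec expr1 mulrA e; field.
      by rewrite gt_eqF.
    rewrite mulrSr opprD addrA; apply: le_trans (_ : x n.+1 / x n - k <= _); last first.
      by rewrite lerB.
    apply: step.
      rewrite divr_gt0//= (le_trans IHn)// gerBl mulrn_wge0// ltW//.
    have := phase_vecSS n (lt0r_neq0 z0); rewrite /= -/x => e.
    transitivity (lam * x n.+2 / x n); first by field; rewrite !gt_eqF.
    by rewrite e; field; rewrite !gt_eqF.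
  have [N hN] : exists N, z^-1 < k *+ N.
    exists (Num.truncn (z^-1 / k)).+1; rewrite -mulr_natr mulrC -ltr_pdivrMr//.
    exact: truncnS_gt.
  have := ratio N; apply/negP; rewrite -ltNge.
    apply: (@lt_trans _ _ 0); last by apply: divr_gt0; exact: x_gt0.
  by rewrite subr_lt0 (lt_le_trans hN)// mulrS lerDr ltW.
case: (ex_minnP ex_neg) => -[|n'] xn' minn'; first by rewrite x00 ltr01 in xn'.
exists n'; split; last by rewrite leNgt.
move=> j jn'; apply/negPn/negP => /minn'; lia.
Qed.

(** If [tau z > 0] the characteristic polynomial has no real root. *)
Lemma discriminant_sign_change z : 0 < z < 1 -> 0 < tau z ->
  exists n, (forall j, (j <= n)%N -> 0 < phase_vec lam mu1 mu2 z j)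
    /\ phase_vec lam mu1 mu2 z n.+1 <= 0.
Proof.
move=> /andP[z0 z1] tz.
have a0 : 0 <= lam * mu1 / z by rewrite divr_ge0 ?mulr_ge0 ?ltW.
have q2 := sqr_sqrtr a0; set q := Num.sqrt _ in q2.
have cq : c z < 2 * q by move: tz; rewrite /tau -/q; lra.
have c0 : 0 < c z by rewrite !addr_gt0// mulr_gt0// subr_gt0.
apply: (@phase_vec_sign_change _ ((q ^+ 2 - (c z / 2) ^+ 2) / lam)); rewrite ?z0//.
  have c2 : 0 <= c z / 2 by lra.
  have c2q : c z / 2 < q by lra.
  by rewrite divr_gt0// subr_gt0 ltrXn2r.
move=> s _; rewrite q2 ler_pdivrMr// -subr_ge0.
rewrite (_ : _ - _ = (lam * s - c z / 2) ^+ 2) ?sqr_ge0//; field.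
by rewrite gt_eqF.
Qed.

(** The characteristic polynomial is positive at [1 / z] exactly when
    [z < lam / mu2], and for [z] not too small [1 / z] lies to the left of its
    vertex, so that it is even larger on the ratios below [1 / z]. *)
Lemma product_sign_change z : lam < mu2 -> mu2 < mu1 ->
  2 * lam / (mu1 + mu2) < z < lam / mu2 ->
  exists n, (forall j, (j <= n)%N -> 0 < phase_vec lam mu1 mu2 z j)
    /\ phase_vec lam mu1 mu2 z n.+1 <= 0.
Proof.
move=> lam_mu2 mu21 /andP[zlow zup].
have z0 : 0 < z by apply: lt_trans zlow; rewrite divr_gt0 ?mulr_gt0 ?addr_gt0.
have zm2 : z * mu2 < lam by rewrite -ltr_pdivlMr.
have z1 : z < 1 by rewrite (lt_trans zup)// ltr_pdivrMr// mul1r.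
have zc : 2 * lam <= z * c z.
  apply: (@le_trans _ _ (z * (mu1 + mu2))).
    by rewrite ltW// -ltr_pdivrMr ?addr_gt0.
  by rewrite ler_pM2l//; lra.
have zi : 1 < z^-1 by rewrite invf_gt1.
apply: (@phase_vec_sign_change _ ((lam / z - mu2) * (z^-1 - 1))); rewrite ?z0//.
  by rewrite mulr_gt0 ?subr_gt0// ltr_pdivlMr// mulrC.
move=> s /andP[s0 sz]; rewrite -subr_ge0.
rewrite (_ : _ - _ = (z^-1 - s) * (c z - lam * (s + z^-1))); last first.
  by field; rewrite gt_eqF.
rewrite mulr_ge0 ?subr_ge0//.
apply: (@le_trans _ _ (lam * (2 / z))).
  by rewrite ler_pM2l//; lra.
by rewrite mulrCA mulrA ler_pdivrMr// [leRHS]mulrC.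
Qed.

End InfiniteCapacity.

(** * Growth rates of the tandem network *)

Section GrowthRates.
Context {R : realType}.
Variables (lam mu1 mu2 : R).
Hypotheses (lam_gt0 : 0 < lam) (mu1_gt0 : 0 < mu1) (mu2_gt0 : 0 < mu2).

(** A positive superharmonic phase vector at [T] gives the upper bound; for the
    lower bound every exponent below [T], and close to it, is enough. *)
Lemma cvg_ln_reach_prob cap i j z0 T x
    (d : measure_display) (Om : measurableType d)
    (P : probability Om R) (X : R -> Om -> nat * nat) :
  markov_jump_process P (tandem_rate lam mu1 mu2 cap) (1%N, i) X ->
  phase_ok cap i -> phase_ok cap j.+1 -> 0 <= z0 < T -> T < 1 ->
  (forall l, phase_ok cap l -> 0 < x l) ->
  (forall l, phase_ok cap l -> phase_op lam mu1 mu2 cap T x l <= 0) ->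
  (forall z, z0 < z < T -> exists2 c, 0 < c & exists K0, forall K, (K0 <= K)%N ->
     c * z ^+ K <= upcross lam mu1 mu2 cap K j (1%N, i)) ->
  ln (reach_prob P X K j) / K%:R @[K --> \oo] --> ln T.
Proof.
move=> XP oki okj /andP[z00 z0T] T1 x0 opx low; have okj' := phase_okS okj.
have T0 := le_lt_trans z00 z0T.
have rE K : reach_prob P X K j = upcross lam mu1 mu2 cap K j (1%N, i).
  exact: reach_probE.
under eq_cvg do rewrite rE.
apply: (@cvg_ln_div_id _ _ z0) => //; first by rewrite z00.
exists (x i / x j / T); first by rewrite !divr_gt0 ?x0.
by exists 1%N => K K0; apply: upcross_le.
Qed.

(** The same vector is used for both bounds, since it is exactly harmonic. *)
Lemma finite_capacity_growth m : (1 <= m)%N -> stable lam mu1 mu2 m ->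
     exists (H : 'M[R]_m.+1) (h : R),
     [/\ minimal_nonneg_solution lam mu1 mu2 H,
         maximal_eigenvalue H h
       & forall i j : nat, (i <= m)%N -> (j < m)%N ->
         forall (d : measure_display) (Om : measurableType d)
           (P : probability Om R) (X : R -> Om -> nat * nat),
         markov_jump_process P (tandem_rate lam mu1 mu2 (Some m)) (1%N, i) X ->
         ln (reach_prob P X K j) / K%:R @[K --> \oo] --> ln h].
Proof.
case: m => // m _ st.
have [h [h01 Xh Eh]] := finite_capacity_root lam_gt0 mu1_gt0 mu2_gt0 st.
have /andP[h0 h1] := h01; have hn0 := lt0r_neq0 h0.
pose x := phase_vec lam mu1 mu2 h.
have x0 j : (j <= m.+1)%N -> 0 < x j by move=> jm; rewrite divr_gt0 ?exprn_gt0 ?Xh.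
have opx j : (j <= m.+1)%N -> phase_op lam mu1 mu2 (Some m.+1) h x j = 0.
  rewrite leq_eqVlt => /orP[/eqP ->|jm]; last exact: phase_vec_harmonic.
  exact: phase_vec_harmonic_top.
exists (passage_mx lam mu1 mu2 m.+1), h; split.
- exact: passage_mx_minimal.
- exact: (@passage_mx_maximal_eigenvalue _ _ _ _ m.+1 lam_gt0 mu1_gt0 mu2_gt0 isT _ x h01 x0 opx).
- move=> i j im jm d Om P X XP.
  apply: (cvg_ln_reach_prob (z0 := 0) (x := x) XP) => //; rewrite ?lexx//.
    by move=> l lm; rewrite opx.
  move=> z /andP[z0 zh].
  have low : exists2 c, 0 < c & exists K0, forall K, (K0 <= K)%N ->
      c * h ^+ K <= upcross lam mu1 mu2 (Some m.+1) K j (1%N, i).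
    apply: (@upcross_ge _ lam mu1 mu2 (Some m.+1) lam_gt0 mu1_gt0 mu2_gt0 h x m.+1) => //=.
      by rewrite ltnn.
    by move=> l lm; rewrite opx.
  have [c c0 [K0 {}low]] := low.
  exists c => //; exists K0 => K K0K; apply: le_trans (low _ K0K).
  by rewrite ler_pM2l// lerXn2r ?nnegrE ?ltW.
Qed.

Lemma upcross_ge_sign_change z i j : 0 < z < 1 ->
  (exists n, (forall l, (l <= n)%N -> 0 < phase_vec lam mu1 mu2 z l)
    /\ phase_vec lam mu1 mu2 z n.+1 <= 0) ->
  exists2 c, 0 < c & exists K0, forall K, (K0 <= K)%N ->
     c * z ^+ K <= upcross lam mu1 mu2 None K j (1%N, i).
Proof.
move=> z01 [n [xn xn1]]; have /andP[z0 _] := z01.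
apply: (@upcross_ge _ lam mu1 mu2 None lam_gt0 mu1_gt0 mu2_gt0 z (phase_vec lam mu1 mu2 z) n) => // l _.
by rewrite phase_vec_harmonic// lt0r_neq0.
Qed.

Lemma infinite_capacity_growth : lam < Num.min mu1 mu2 ->
     exists eta : R,
     [/\ 0 < eta < 1,
         tau lam mu1 mu2 eta = 0,
         (forall z : R, 0 < z < 1 -> tau lam mu1 mu2 z = 0 -> z = eta)
       & forall (i j : nat)
           (d : measure_display) (Om : measurableType d)
           (P : probability Om R) (X : R -> Om -> nat * nat),
         markov_jump_process P (tandem_rate lam mu1 mu2 None) (1%N, i) X ->
         (mu1 <= mu2 ->
            ln (reach_prob P X K j) / K%:R @[K --> \oo] --> ln eta) /\
         (mu2 < mu1 ->
            ln (reach_prob P X K j) / K%:R @[K --> \oo] --> ln (lam / mu2))].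
Proof.
rewrite lt_min => /andP[lam_mu1 lam_mu2].
have [eta [eta01 teta]] := tau_root mu2 lam_gt0 mu1_gt0 lam_mu1.
exists eta; split => // [z z01 tz|]; first exact: (tau_root_unique lam_gt0 mu1_gt0 mu2_gt0 lam_mu1).
have /andP[eta0 eta1] := eta01.
move=> i j d Om P X XP; split=> mu12.
- have le := tau_root_le lam_gt0 mu1_gt0 mu2_gt0 lam_mu1 mu12 eta01 teta.
  apply: (cvg_ln_reach_prob (z0 := 0) (x := root_phase_vec lam mu1 eta) XP) => //.
  + by rewrite lexx.
  + by move=> l _; exact: root_phase_vec_gt0.
  + by move=> l _; rewrite root_phase_vec_harmonic.
  move=> z /andP[z0 zeta]; have z1 := lt_trans zeta eta1.
  apply: upcross_ge_sign_change; first by rewrite z0.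
  apply: discriminant_sign_change; rewrite ?z0// ltNge; apply/negP => tz.
  by have := tau_lt0 lam_gt0 mu1_gt0 mu2_gt0 lam_mu1 z0 zeta eta1 tz; rewrite teta ltxx.
- have rho1 : lam / mu2 < 1 by rewrite ltr_pdivrMr// mul1r.
  apply: (cvg_ln_reach_prob (z0 := 2 * lam / (mu1 + mu2)) (x := fun j => (mu2 / lam) ^+ j) XP) => //.
  + rewrite divr_ge0 ?mulr_ge0 ?addr_ge0 ?ltW//= ltr_pdivrMr ?addr_gt0// mulrAC.
    rewrite ltr_pdivlMr// -subr_gt0 (_ : _ - _ = lam * (mu1 - mu2)); last by ring.
    by rewrite mulr_gt0// subr_gt0.
  + by move=> l _; rewrite exprn_gt0// divr_gt0.
  + by move=> l _; rewrite product_phase_vec_harmonic.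
  move=> z /andP[zlow zup].
  have z0 : 0 < z by apply: lt_trans zlow; rewrite divr_gt0 ?mulr_gt0 ?addr_gt0.
  apply: upcross_ge_sign_change; first by rewrite z0 (lt_trans zup).
  by apply: product_sign_change => //; rewrite zlow.
Qed.

End GrowthRates.

(* For finite m the phase is at most m - 1 whenever a new level is reached by
   an upward step, so the hitting probability vanishes at phase j = m (for
   2 <= K) and its logarithm is undefined: hence j < m in the first part.
   H and h are uniquely determined by the predicates they satisfy. *)
Theorem theorem8p2 (R : realType) (lam mu1 mu2 : R)
    (lam_gt0 : 0 < lam) (mu1_gt0 : 0 < mu1) (mu2_gt0 : 0 < mu2) :
  (forall m : nat, (1 <= m)%N -> stable lam mu1 mu2 m ->
     exists (H : 'M[R]_m.+1) (h : R),
     [/\ minimal_nonneg_solution lam mu1 mu2 H,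
         maximal_eigenvalue H h
       & forall i j : nat, (i <= m)%N -> (j < m)%N ->
         forall (d : measure_display) (Om : measurableType d)
           (P : probability Om R) (X : R -> Om -> nat * nat),
         markov_jump_process P (tandem_rate lam mu1 mu2 (Some m)) (1%N, i) X ->
         ln (reach_prob P X K j) / K%:R @[K --> \oo] --> ln h])
  /\
  (lam < Num.min mu1 mu2 ->
     exists eta : R,
     [/\ 0 < eta < 1,
         tau lam mu1 mu2 eta = 0,
         (forall z : R, 0 < z < 1 -> tau lam mu1 mu2 z = 0 -> z = eta)
       & forall (i j : nat)
           (d : measure_display) (Om : measurableType d)
           (P : probability Om R) (X : R -> Om -> nat * nat),
         markov_jump_process P (tandem_rate lam mu1 mu2 None) (1%N, i) X ->
         (mu1 <= mu2 ->
            ln (reach_prob P X K j) / K%:R @[K --> \oo] --> ln eta) /\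
         (mu2 < mu1 ->
            ln (reach_prob P X K j) / K%:R @[K --> \oo] --> ln (lam / mu2))]).
Proof.
by split; [exact: finite_capacity_growth|exact: infinite_capacity_growth].
Qed.
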